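(* Let $q>0$ be an even integer and $0\le b\le q$. Let $\widetilde{\mathsf{Bi}}(q-b,b)$ be the set of isomorphism classes (of unitary $\mathrm{BT}_1$ modules) of unitary bicycles of signature $(q-b,b)$. Then $$\#\widetilde{\mathsf{Bi}}(q-b,b)=\frac1q\left(\#\mathsf P_q^{\delta_0=b}-\#\mathsf U_q^{\delta_0=b}\right).$$ Explicitly, $$\#\widetilde{\mathsf{Bi}}(q/2,q/2)=\begin{cases}\displaystyle\frac1q\Big(\sum_{d\in\mathscr D_{\mathrm{co\text{-}even}}(q)}\mu(d)\binom{q/d}{q/2d}+\sum_{d\in\mathscr D_{\mathrm{co\text{-}odd}}(q)}\mu(d)\,2^{q/d}-\sum_{d\in\mathscr D_{\mathrm{odd}}(q)}\mu(d)\,2^{q/2d}\Big)&\text{if }q\equiv0\bmod4,\\[1em]\displaystyle\frac1q\Big(\sum_{d\in\mathscr D_{\mathrm{co\text{-}even}}(q)}\mu(d)\binom{q/d}{q/2d}+\sum_{d\in\mathscr D_{\mathrm{co\text{-}odd}}(q)}\mu(d)\,2^{q/d}\Big)&\text{if }q\equiv2\bmod4;\end{cases}$$ and, for $b\neq q/2$, $$\#\widetilde{\mathsf{Bi}}(q-b,b)=\begin{cases}\displaystyle\frac1q\Big(\sum_{d\in\mathscr D_{\mathrm{w.co\text{-}even}}(\gcd(q,b))}\mu(d)\binom{q/d}{b/d}-\sum_{d\in\mathscr D_{\mathrm{odd}}(\gcd(q,b))}\mu(d)\binom{q/2d}{b/2d}\Big)&\text{if }q\equiv2\bmod4\text{ and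 }b\text{ is even},\\[1em]\displaystyle\frac1q\sum_{d\in\mathscr D_{\mathrm{w.co\text{-}even}}(\gcd(q,b))}\mu(d)\binom{q/d}{b/d}&\text{otherwise}.\end{cases}$$
   Context: $k$ is an algebraically closed field of prime characteristic $p>2$. $\mu$ is the Möbius function; $q/2d$ means $q/(2d)$; $\gcd(q,0)=q$. Divisor sets: $\mathscr D(n)$ is the set of positive divisors of $n$; $\mathscr D_{\mathrm{odd}}(n)$ those that are odd; $\mathscr D_{\mathrm{co\text{-}even}}(q)=\{d\in\mathscr D(q): q/d\text{ even}\}$; $\mathscr D_{\mathrm{co\text{-}odd}}(q)=\{d\in\mathscr D(q):q/d\text{ odd}\}$; $\mathscr D_{\mathrm{w.co\text{-}even}}(\gcd(q,b))=\{d\in\mathscr D(\gcd(q,b)): q/d\text{ even}\}$. Words: a word is a nonempty finite string $w=u_{\ell-1}\cdots u_0$ in $\{\mathtt f,\mathtt v\}$ of length $\ell(w)=\ell$; $w$ is primitive if it is not a concatenation of $n>1$ copies of a shorter word; $w^\star$ is obtained by exchanging $\mathtt f$ and $\mathtt v$; $\tau(u_{\ell-1}\cdots u_0)=u_0u_{\ell-1}\cdots u_1$; $w$ is self-dual if $w^\star=\tau^n(w)$ for some $n$. For $w$ of even length $\ell$, $\delta_0(w)=\#\{0\le j<\ell/2:u_{2j}=\mathtt v\}+\#\{1\le j\le\ell/2:u_{2j-1}=\mathtt f\}$. $\mathsf P_q^{\delta_0=b}$ is the set of primitive words $w$ of length $q$ with $\delta_0(w)=b$; $\mathsf U_q^{\delta_0=b}$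 is its subset of self-dual words. A unitary $\mathrm{BT}_1$ module is $(M,F,V,\lambda,M=M_0\oplus M_1)$ with $M$ a finite-dimensional $k$-vector space, $F$ Frobenius-linear, $V$ inverse-Frobenius-linear, $\ker F=\operatorname{im}V$, $\ker V=\operatorname{im}F$, $\lambda$ a symplectic form on $M$ with $\lambda(F(x),y)=\lambda(x,V(y))^p$, $F,V$ mapping $M_i$ into $M_{1-i}$, and $M_0,M_1$ Lagrangian. Its signature is $(\dim_k\ker(F|_{M_1}),\dim_k\ker(F|_{M_0}))$. Isomorphisms respect all the structure. $\overline M(w)$ has $k$-basis $a_0,\dots,a_{\ell-1}$ (indices mod $\ell$) with $F(a_j)=a_{j+1}$ if $u_j=\mathtt f$ and $0$ if $u_j=\mathtt v$; $V(a_{j+1})=a_j$ if $u_j=\mathtt v$ and $0$ if $u_j=\mathtt f$. A unitary bicycle is a module $\widetilde M(w,w^\star)$ with $w$ primitive, non-self-dual, of even length: the underlying module is $\overline M(w)\oplus\overline M(w^\star)$ (standard bases $a_j$, $b_j$), the symplectic form is determined by $\lambda(a_i,b_j)=\delta_{i,j}$, $\lambda(a_i,a_j)=\lambda(b_i,b_j)=0$, $M_0$ is spanned by the $a_j$ ($j$ even) and $b_j$ ($j$ odd), and $M_1$ by the $a_j$ ($j$ odd) and $b_j$ ($j$ even). *)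

(* Defs.v *)
From HB Require Import structures.
From mathcomp Require Import all_boot all_order all_algebra.
From mathcomp Require Import boolp classical_sets cardinality.

Set Implicit Arguments.
Unset Strict Implicit.
Unset Printing Implicit Defensive.

Import GRing.Theory.

Definition mobius (n : nat) : int :=
  if all (fun p => logn p n == 1) (primes n) then ((-1) ^+ size (primes n))%R
  else 0%R.

Definition odd_divisors (n : nat) : seq nat := [seq d <- divisors n | odd d].

Definition coeven_divisors (q : nat) : seq nat :=
  [seq d <- divisors q | ~~ odd (q %/ d)].

Definition coodd_divisors (q : nat) : seq nat :=
  [seq d <- divisors q | odd (q %/ d)].

(* The divisors of gcd(q,b) that are co-even with respect to q (and not with
   respect to gcd(q,b)). *)
Definition wcoeven_divisors (q b : nat) : seq nat :=
  [seq d <- divisors (gcdn q b) | ~~ odd (q %/ d)].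

Inductive letter : Set := Lf | Lv.

Definition bool_of_letter (c : letter) : bool := if c is Lv then true else false.
Definition letter_of_bool (x : bool) : letter := if x then Lv else Lf.

Fact bool_of_letterK : cancel bool_of_letter letter_of_bool.
Proof. by case. Qed.

HB.instance Definition _ := Finite.copy letter (can_type bool_of_letterK).

(* A word u_(l-1) ... u_1 u_0 of length l is encoded by the tuple
   [u_0; u_1; ...; u_(l-1)], read from right to left, so that u_j is the entry
   of index j. *)
Notation word l := (l.-tuple letter).

Definition dual_letter (c : letter) : letter := if c is Lf then Lv else Lf.

Definition dual (l : nat) (w : word l) : word l := [tuple of map dual_letter w].

(* tau (u_(l-1) ... u_0) = u_0 u_(l-1) ... u_1; in the reversed encoding, this
   moves the first entry u_0 to the last place. *)
Definition tau (l : nat) (w : word l) : word l := [tuple of rot 1 w].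

Definition primitive (l : nat) (w : word l) : Prop :=
  forall (n : nat) (s : seq letter),
    (1 < n)%N -> (size s < l)%N -> tval w <> flatten (nseq n s).

Definition self_dual (l : nat) (w : word l) : Prop :=
  exists n : nat, dual w = iter n (@tau l) w.

(* For l even; all the indices below are then smaller than l. *)
Definition delta0 (l : nat) (w : word l) : nat :=
  (\sum_(0 <= j < l./2) (nth Lf w (2 * j) == Lv)
   + \sum_(1 <= j < l./2.+1) (nth Lv w (2 * j - 1) == Lf))%N.

Definition Pset (q b : nat) : {set word q} :=
  [set w : word q | `[< primitive w >] && (delta0 w == b)]%SET.

Definition Uset (q b : nat) : {set word q} :=
  [set w in Pset q b | `[< self_dual w >]]%SET.

Section UnitaryBT1.

Local Open Scope ring_scope.
Local Open Scope classical_set_scope.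

Variables (k : closedFieldType) (p : nat).

Definition frobenius_linear (M : vectType k) (F : M -> M) : Prop :=
  (forall x y, F (x + y) = F x + F y)
  /\ (forall (c : k) x, F (c *: x) = c ^+ p *: F x).

(* V (c x) = c^(1/p) V x, written without p-th roots. *)
Definition inv_frobenius_linear (M : vectType k) (V : M -> M) : Prop :=
  (forall x y, V (x + y) = V x + V y)
  /\ (forall (c : k) x, V (c ^+ p *: x) = c *: V x).

Definition lagrangian (M : vectType k) (lam : {skew_symmetric M})
  (L : {vspace M}) : Prop := orthov lam L = L.

Record unitaryBT1 := UnitaryBT1 {
  carrier :> vectType k;
  Frob : carrier -> carrier;
  Ver : carrier -> carrier;
  pairing : {skew_symmetric carrier};
  gr0 : {vspace carrier};
  gr1 : {vspace carrier};
  Frob_lin : frobenius_linear Frob;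
  Ver_lin : inv_frobenius_linear Ver;
  kerFrob : forall x, Frob x = 0 <-> exists y, x = Ver y;
  kerVer : forall x, Ver x = 0 <-> exists y, x = Frob y;
  pairing_symplectic : is_psymplectic pairing;
  pairing_FV : forall x y, pairing (Frob x) y = (pairing x (Ver y)) ^+ p;
  gr_sum : (gr0 + gr1)%VS = fullv;
  gr_direct : (gr0 :&: gr1)%VS = 0%VS;
  Frob_gr0 : forall x, x \in gr0 -> Frob x \in gr1;
  Frob_gr1 : forall x, x \in gr1 -> Frob x \in gr0;
  Ver_gr0 : forall x, x \in gr0 -> Ver x \in gr1;
  Ver_gr1 : forall x, x \in gr1 -> Ver x \in gr0;
  gr0_lagrangian : lagrangian pairing gr0;
  gr1_lagrangian : lagrangian pairing gr1
}.

Definition has_dim (M : vectType k) (A : set M) (n : nat) : Prop :=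
  exists U : {vspace M}, A = [set x | x \in U] /\ \dim U = n.

Definition has_signature (M : unitaryBT1) (s : nat * nat) : Prop :=
  has_dim [set x : M | x \in gr1 M /\ Frob x = 0] s.1
  /\ has_dim [set x : M | x \in gr0 M /\ Frob x = 0] s.2.

Definition isomorphic (M N : unitaryBT1) : Prop :=
  exists phi : 'Hom(M, N),
    [/\ bijective phi,
        (forall x, phi (Frob x) = Frob (phi x)),
        (forall x, phi (Ver x) = Ver (phi x)),
        (forall x y, pairing N (phi x) (phi y) = pairing M x y)
      & (phi @: gr0 M)%VS = gr0 N /\ (phi @: gr1 M)%VS = gr1 N].

(* Classes are unary predicates rather than terms of type [set unitaryBT1],
   whose universe is too small for structures over arbitrary carriers. *)
Definition iso_class (M : unitaryBT1) : unitaryBT1 -> Prop := isomorphic M.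

(* F and V act on the vectors a_0, ..., a_(l-1) as they do on the standard
   basis of the module attached to w; ordS is the successor modulo l. *)
Definition std_action (M : unitaryBT1) (l : nat) (w : word l) (a : 'I_l -> M)
    : Prop :=
  forall j : 'I_l,
    Frob (a j) = (if tnth w j == Lf then a (ordS j) else 0)
    /\ Ver (a (ordS j)) = (if tnth w j == Lv then a j else 0).

(* M is (up to renaming of the standard bases) the module attached to the pair
   of w and its dual. *)
Definition is_Mtilde (l : nat) (w : word l) (M : unitaryBT1) : Prop :=
  exists a b : 'I_l -> M,
    [/\ basis_of fullv (codom a ++ codom b),
        std_action w a /\ std_action (dual w) b,
        (forall i j, [/\ pairing M (a i) (b j) = (i == j)%:R,
                         pairing M (a i) (a j) = 0
                       & pairing M (b i) (b j) = 0]),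
        gr0 M = (<<[seq a j | j : 'I_l <- enum 'I_l & ~~ odd j]
                   ++ [seq b j | j : 'I_l <- enum 'I_l & odd j]>>)%VS
      & gr1 M = (<<[seq a j | j : 'I_l <- enum 'I_l & odd j]
                   ++ [seq b j | j : 'I_l <- enum 'I_l & ~~ odd j]>>)%VS].

Definition unitary_bicycle (M : unitaryBT1) : Prop :=
  exists (l : nat) (w : word l),
    [/\ (0 < l)%N, ~~ odd l, primitive w, ~ self_dual w & is_Mtilde w M].

Definition Bi_tilde (s : nat * nat) : (unitaryBT1 -> Prop) -> Prop :=
  fun C => exists M, [/\ unitary_bicycle M, has_signature M s
                       & C = iso_class M].

End UnitaryBT1.

Arguments Bi_tilde k p s C : clear implicits.

(* The library's equipotence [A #= `I_N], spelled out because of the same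
   universe limitation. *)
Definition has_card (T : Type) (A : T -> Prop) (N : nat) : Prop :=
  exists f : 'I_N -> T,
    (forall i j, f i = f j -> i = j) /\ (forall x, A x <-> exists i, x = f i).

(* Main.v *)
(* The rotated dual [twist w = (tau w)^*] describes the same bicycle as [w]:
   exchange the two cycles and turn them by one step, which restores the
   grading.  Conversely, a graded morphism between two bicycles sends the base
   vector with word [w'] to a nonzero vector, and following [F] and [V^-1] along
   [w'] shows that [w'] is lexicographically (f < v) at most the word of every
   basis vector in its support.  Hence isomorphic bicycles have orbits under
   [twist] with the same maximum, that is, the same orbit.  Orbits of primitive
   non-self-dual words have exactly [q] elements.

   Recording a word by the bits [(u_j == v) (+) odd j] turns [delta0] into the
   number of bits and [twist] into a rotation.  Primitive words are then counted
   by Moebius inversion from the words fixed by [tau^(q/d)], whose bits are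
   periodic or complemented after [q/d] steps. *)

From HB Require Import structures.
Require Import Defs.
From mathcomp Require Import all_boot all_order all_algebra.
From mathcomp Require Import boolp classical_sets cardinality.

Set Implicit Arguments.
Unset Strict Implicit.
Unset Printing Implicit Defensive.

Import GRing.Theory.

(** * Modules with a standard basis *)

Section StandardBasis.
Local Open Scope ring_scope.
Variables (k : closedFieldType) (p : nat).
Hypothesis hp : p \in [pchar k].
Implicit Types M N : unitaryBT1 k p.

(** An isomorphism need not carry one standard basis to another: the image of [a_0] may have several
    nonzero coordinates, so its word cannot simply be read off. This is why a morphism only yields
    an inequality between words, to be used for an isomorphism and for its inverse, at the maximum
    of an orbit. The two cycles are merged into one family indexed by [bool * 'I_l], on which [F],
    [V], the form and the grading follow uniform rules; passing from a cycle to its dual negates the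
    first component. Coordinates are pairings with dual basis vectors, so that independence,
    linearity and compatibility with the grading all come from the form. The signature knows both
    the length and [delta0]. For each position [j] exactly one of [a_j], [b_j] lies in [M_0], and
    [F] kills it exactly when [j] is one of the bits. The kernel of [F] thus has as dimension the
    number of bits on [M_0] and the number of non-bits on [M_1], so a bicycle of signature
    [(q - b, b)] comes from a word of length [q] with [delta0] equal to [b]. *)

Definition graded M (d : bool) : {vspace M} := if d then gr1 M else gr0 M.

Lemma Frob_sum M (I : Type) (r : seq I) (c : I -> k) (u : I -> M) :
  Frob (\sum_(i <- r) c i *: u i) = \sum_(i <- r) c i ^+ p *: Frob (u i).
Proof.
have [FD FZ] := Frob_lin M.
have F0 : Frob (0 : M) = 0 by apply: (addrI (Frob 0)); rewrite -FD !addr0.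
by elim: r => [|i r IH]; rewrite ?big_nil // !big_cons FD FZ IH.
Qed.

Lemma Ver_sum M (I : Type) (r : seq I) (c : I -> k) (u : I -> M) :
  Ver (\sum_(i <- r) c i ^+ p *: u i) = \sum_(i <- r) c i *: Ver (u i).
Proof.
have [VD VZ] := Ver_lin M.
have V0 : Ver (0 : M) = 0 by apply: (addrI (Ver 0)); rewrite -VD !addr0.
by elim: r => [|i r IH]; rewrite ?big_nil // !big_cons VD VZ IH.
Qed.

Lemma exists_proot (c : k) : exists r, r ^+ p = c.
Proof.
have p_gt0 := prime_gt0 (pcharf_prime hp).
(* [solve_monicpoly] solves [r ^+ p = \sum_(i < p) c_i * r ^+ i]; here only the constant coefficient
   is nonzero. *)
have [r] := @solve_monicpoly k p (fun i => if i == 0%N then c else 0 : k) p_gt0.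
move=> er; exists r; rewrite {}er; case: p p_gt0 => // n _.
rewrite big_ord_recl big1 /= ?mulr1 ?addr0 // => i _.
by rewrite mul0r.
Qed.

Definition proot (c : k) : k := sval (cid (exists_proot c)).

Lemma prootK c : proot c ^+ p = c.
Proof. exact: (svalP (cid (exists_proot c))). Qed.

Lemma expKproot c : proot (c ^+ p) = c.
Proof. exact: (fmorph_inj (pFrobenius_aut hp)) (prootK _). Qed.

Section Basis.
Variables (l : nat) (w : word l).
Implicit Types (i j : bool * 'I_l).

(* The index [(false, j)] stands for the vector [a_j] of the cycle of [w], and
   [(true, j)] for the vector [b_j] of the cycle of the dual word. *)
Definition is_f i := tnth w i.2 == (if i.1 then Lv else Lf).
Definition succ_idx i := (i.1, ordS i.2).
Definition dual_idx i := (~~ i.1, i.2).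
(** The degree of the basis vector: [a_j] lies in [M_0] for [j] even, [b_j] for [j] odd. *)
Definition parity i := i.1 (+) odd i.2.

Record standard_basis M (e : bool * 'I_l -> M) : Prop := StandardBasis {
  sb_span : forall x, exists c, x = \sum_i c i *: e i;
  sb_Frob : forall i, Frob (e i) = if is_f i then e (succ_idx i) else 0;
  sb_Ver : forall i, Ver (e (succ_idx i)) = if is_f i then 0 else e i;
  sb_pairing : forall i j,
    pairing M (e i) (e j) = if i == dual_idx j then (-1) ^+ i.1 else 0;
  sb_graded : forall i, e i \in graded M (parity i)
}.

Lemma dual_idxK : involutive dual_idx.
Proof. by case=> s j; rewrite /dual_idx /= negbK. Qed.

Lemma pairing_suml M (I : finType) (c : I -> k) (u : I -> M) y :
  pairing M (\sum_i c i *: u i) y = \sum_i c i * pairing M (u i) y.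
Proof. by rewrite linear_sumlz; apply: eq_bigr => i _; rewrite linearZl_LR. Qed.

Lemma pairing_sumr M (I : finType) (c : I -> k) (u : I -> M) y :
  pairing M y (\sum_i c i *: u i) = \sum_i c i * pairing M y (u i).
Proof. by rewrite linear_sumr; apply: eq_bigr => i _; rewrite linearZr_LR. Qed.

Section OneModule.
Variables (M : unitaryBT1 k p) (e : bool * 'I_l -> M).
Hypothesis he : standard_basis e.

(** A basis vector pairs nontrivially only with its dual, and [(-1) ^+ i.1] cancels the sign of that
    pairing. *)
Definition coordinate i x := (-1) ^+ i.1 * pairing M x (e (dual_idx i)).

Lemma coordinate_lincomb c i : coordinate i (\sum_j c j *: e j) = c i.
Proof.
rewrite /coordinate pairing_suml (bigD1 i) //= big1 => [|j ji].
  by rewrite (sb_pairing he) dual_idxK eqxx addr0 mulrCA -signr_addb addbb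
    mulr1.
by rewrite (sb_pairing he) dual_idxK (negPf ji) mulr0.
Qed.

Lemma coordinate_expand x : x = \sum_i coordinate i x *: e i.
Proof.
by have [c ->] := sb_span he x; apply: eq_bigr => i _;
  rewrite coordinate_lincomb.
Qed.

Lemma coordinate_basis i j : coordinate i (e j) = (i == j)%:R.
Proof.
have {1}-> : e j = \sum_i (i == j)%:R *: e i; last by rewrite
  coordinate_lincomb.
rewrite (bigD1 j) //= eqxx scale1r big1 ?addr0 // => a /negPf->.
by rewrite scale0r.
Qed.

(* If [i] has the wrong degree, then [e (dual_idx i)] lies in the same
  Lagrangian
   subspace as [x]. *)
Lemma coordinate_graded x d i : x \in graded M d -> parity i != d ->
  coordinate i x = 0.
Proof.
move=> xd di.
have ei : e (dual_idx i) \in graded M d.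
  have -> : d = parity (dual_idx i); last exact: sb_graded.
  by clear xd; move: di; rewrite /parity /= addNb; case: (_ (+) _) d => [] [].
rewrite /coordinate; suff -> : pairing M x (e (dual_idx i))
  = 0 by rewrite mulr0.
case: d xd ei {di} => /= xd.
  by apply/mem_orthovP: (e _); rewrite gr1_lagrangian.
by apply/mem_orthovP: (e _); rewrite gr0_lagrangian.
Qed.

Lemma coordinateD i x y : coordinate i (x + y)
  = coordinate i x + coordinate i y.
Proof. by rewrite /coordinate linearDl mulrDr. Qed.

Lemma coordinateZ i c x : coordinate i (c *: x) = c * coordinate i x.
Proof. by rewrite /coordinate linearZl_LR mulrCA. Qed.


End OneModule.

Section Isomorphism.
Variables (M N : unitaryBT1 k p).
Variables (e : bool * 'I_l -> M) (e' : bool * 'I_l -> N).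
Hypotheses (he : standard_basis e) (he' : standard_basis e').

Definition basis_map (x : M) : N := \sum_i coordinate e i x *: e' i.

Lemma basis_map_linear : linear basis_map.
Proof.
move=> c x y; rewrite /basis_map scaler_sumr -big_split /=.
by apply: eq_bigr => i _; rewrite coordinateD coordinateZ scalerDl scalerA.
Qed.

HB.instance Definition _ :=
  GRing.isLinear.Build k M N *:%R basis_map basis_map_linear.

Lemma basis_mapE c : basis_map (\sum_i c i *: e i) = \sum_i c i *: e' i.
Proof. by apply: eq_bigr => i _; rewrite coordinate_lincomb. Qed.

Lemma basis_map_basis i : basis_map (e i) = e' i.
Proof.
rewrite /basis_map (bigD1 i) //= coordinate_basis //
  eqxx scale1r big1 ?addr0 //.
by move=> j /negPf ji; rewrite coordinate_basis // ji scale0r.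
Qed.

Lemma basis_map_Frob x : basis_map (Frob x) = Frob (basis_map x).
Proof.
have [c ->] := sb_span he x; rewrite basis_mapE !Frob_sum linear_sum.
apply: eq_bigr => i _; rewrite linearZ /= (sb_Frob he) (sb_Frob he').
by case: ifP; rewrite ?linear0 // basis_map_basis.
Qed.

Lemma basis_map_Ver x : basis_map (Ver x) = Ver (basis_map x).
Proof.
have [c ->] := sb_span he x; rewrite basis_mapE.
(* [V] takes [p]-th roots of scalars, so [Ver_sum] requires coefficients written as [p]-th
   powers. *)
under eq_bigr do rewrite -[c _]prootK.
under [in RHS]eq_bigr do rewrite -[c _]prootK.
rewrite !Ver_sum linear_sum; apply: eq_bigr => -[s j] _.
rewrite linearZ /= -[(s, j)]/(s, j).
(* [sb_Ver] describes [V] on successors, and every index is one. *)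
have <- : succ_idx (s, ord_pred j) = (s, j) by rewrite /succ_idx /= ord_predK.
rewrite (sb_Ver he) (sb_Ver he').
by case: ifP; rewrite ?linear0 // basis_map_basis.
Qed.

Lemma basis_map_pairing x y :
  pairing N (basis_map x) (basis_map y) = pairing M x y.
Proof.
have [c ->] := sb_span he x; have [d ->] := sb_span he y.
rewrite !basis_mapE !pairing_suml; apply: eq_bigr => i _.
rewrite !pairing_sumr; congr (_ * _); apply: eq_bigr => j _.
by rewrite (sb_pairing he) (sb_pairing he').
Qed.

Lemma basis_map_graded x d : x \in graded M d -> basis_map x \in graded N d.
Proof.
move=> xd; apply: memv_suml => i _.
have [<-|di] := eqVneq (parity i) d; first by rewrite memvZ // sb_graded.
by rewrite (coordinate_graded he xd) // scale0r mem0v.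
Qed.

End Isomorphism.

Lemma basis_mapK M N (e : bool * 'I_l -> M) (e' : bool * 'I_l -> N) :
  standard_basis e -> standard_basis e' ->
  cancel (basis_map e e') (basis_map e' e).
Proof.
by move=> he he' x; rewrite [RHS](coordinate_expand he x) -(basis_mapE e he').
Qed.

Lemma standard_basis_isomorphic M N
    (e : bool * 'I_l -> M) (e' : bool * 'I_l -> N) :
  standard_basis e -> standard_basis e' -> isomorphic M N.
Proof.
move=> he he'; exists (linfun (basis_map e e')).
have gr d : (linfun (basis_map e e') @: graded M d)%VS = graded N d.
  apply/eqP; rewrite eqEsubv; apply/andP; split; apply/subvP => y.
    by case/memv_imgP => x xd ->; rewrite lfunE; apply: basis_map_graded.
  move=> yd; apply/memv_imgP; exists (basis_map e' e y).
    exact: basis_map_graded.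
  by rewrite lfunE /= basis_mapK.
split; last by split; [apply: (gr false) | apply: (gr true)].
- exists (basis_map e' e) => x; rewrite lfunE /=; exact: basis_mapK.
- by move=> x; rewrite !lfunE; apply: basis_map_Frob.
- by move=> x; rewrite !lfunE; apply: basis_map_Ver.
- by move=> x y; rewrite !lfunE; apply: basis_map_pairing.
Qed.


(** * Coordinates of images, spans of basis vectors, and the signature *)

Section Spans.
Variables (M : unitaryBT1 k p) (e : bool * 'I_l -> M).
Hypothesis he : standard_basis e.

Lemma coordinate_sum i (J : finType) (c : J -> k) (u : J -> M) :
  coordinate e i (\sum_j c j *: u j) = \sum_j c j * coordinate e i (u j).
Proof.
by rewrite /coordinate pairing_suml mulr_sumr; apply: eq_bigr => j _;
  rewrite mulrCA.
Qed.

Lemma succ_idx_inj : injective succ_idx.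
Proof.
move=> [s j] [t h] E; have /= -> := congr1 fst E.
by have /= -> := ordS_inj (congr1 snd E).
Qed.

Lemma Frob0 : Frob (0 : M) = 0.
Proof. by have := @Frob_sum M nat [::] (fun=> 0) (fun=> 0);
  rewrite !big_nil. Qed.

Lemma coordinate0 i : coordinate e i 0 = 0.
Proof. by rewrite /coordinate linear0l mulr0. Qed.

Lemma coordinate_Frob i x :
  coordinate e (succ_idx i) (Frob x) = if is_f i then coordinate e i x ^+ p
    else 0.
Proof.
rewrite {1}(coordinate_expand he x) Frob_sum coordinate_sum (bigD1 i) //= big1
  => [|j ji].
  rewrite addr0 (sb_Frob he); case: ifP => _; last by rewrite coordinate0 mulr0.
  by rewrite coordinate_basis // eqxx mulr1.
rewrite (sb_Frob he); case: ifP => _; last by rewrite coordinate0 mulr0.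
by rewrite coordinate_basis // (inj_eq succ_idx_inj) eq_sym (negPf ji) mulr0.
Qed.

(** The zero case is what the comparison of words rests on: an image of [V] has no component at an
    index whose basis vector survives [F]. The [p]-th power avoids roots. *)
Lemma coordinate_Ver i x :
  coordinate e i (Ver x) ^+ p = if is_f i then 0 else coordinate e (succ_idx i)
    x.
Proof.
have p_gt0 := prime_gt0 (pcharf_prime hp).
have coefV j : coordinate e i (Ver (e (succ_idx j)))
  = if is_f i then 0 else (i == j)%:R.
  rewrite (sb_Ver he); have [<-|ij] := eqVneq i j.
    by case: ifP; rewrite ?coordinate0 // coordinate_basis // eqxx.
  by case: (is_f j); case: (is_f i); rewrite ?coordinate0 //
    coordinate_basis // (negPf ij).
pose c j := proot (coordinate e (succ_idx j) x).
have -> : x = \sum_j c j ^+ p *: e (succ_idx j).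
  rewrite [LHS](coordinate_expand he x) (reindex_inj succ_idx_inj).
  by apply: eq_bigr => j _; rewrite prootK.
rewrite Ver_sum !coordinate_sum (bigD1 i) //= big1 => [|j ji]; last first.
  by rewrite coefV eq_sym (negPf ji); case: ifP; rewrite mulr0.
rewrite coefV eqxx addr0 (bigD1 i) //= big1 => [|j ji]; last first.
  by rewrite coordinate_basis // (inj_eq succ_idx_inj) eq_sym (negPf ji) mulr0.
rewrite coordinate_basis // eqxx addr0 mulr1.
by case: ifP; rewrite ?mulr1 // mulr0 expr0n gtn_eqF.
Qed.

Lemma coordinate_is_linear i : linear (coordinate e i : M -> k^o).
Proof. by move=> c x y; rewrite coordinateD coordinateZ. Qed.

Lemma mem_basis_spanP (s : seq (bool * 'I_l)) x :
  reflect (forall i, i \notin s -> coordinate e i x = 0)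
          (x \in <<[seq e i | i <- s]>>)%VS.
Proof.
apply: (iffP idP) => [xs i si|x0]; last first.
  rewrite (coordinate_expand he x); apply: memv_suml => i _.
  have [si|si] := boolP (i \in s); last by rewrite (x0 _ si) scale0r mem0v.
  by rewrite memvZ // memv_span // map_f.
pose f : {linear M -> k^o} :=
  HB.pack (coordinate e i : M -> k^o) (GRing.isLinear.Build _ _ _ _ _
    (coordinate_is_linear i)).
have: (<<[seq e i | i <- s]>> <= lker (linfun f))%VS.
  apply/span_subvP => _ /mapP[j sj ->]; rewrite memv_ker lfunE /=.
  rewrite coordinate_basis //; have [ij|_] := eqVneq i j; last by rewrite eqxx.
  by rewrite ij sj in si.
by move=> /subvP/(_ _ xs); rewrite memv_ker lfunE => /eqP.
Qed.

Lemma free_basis s : uniq s -> free [seq e i | i <- s].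
Proof.
elim: s => [|i s IH] /=; first by rewrite nil_free.
case/andP=> si /IH; rewrite free_cons => ->; rewrite andbT.
apply/mem_basis_spanP => /(_ _ si); rewrite coordinate_basis // eqxx.
exact/eqP/oner_neq0.
Qed.

Lemma basis_spanf s : (forall i, i \in s) -> (fullv <= <<[seq e i | i <-
  s]>>)%VS.
Proof. by move=> ss; apply/subvP => x _; apply/mem_basis_spanP => i;
  rewrite ss. Qed.

(** [F] sends the basis vectors that it does not kill to distinct basis vectors, so [F x = 0] forces
    the coordinates of [x] along them to vanish, although [F] is only semilinear. *)
Lemma kerFrobP d x :
  x \in graded M d /\ Frob x = 0 <->
  x \in <<[seq e i | i <- enum [pred i | (parity i == d) && ~~ is_f i]]>>%VS.
Proof.
split=> [[xd Fx]|/mem_basis_spanP xs].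
  apply/mem_basis_spanP => i; rewrite mem_enum inE negb_and negbK.
  case/orP=> [di|fi]; first exact: (coordinate_graded he xd).
  by apply/eqP; have := coordinate_Frob i x; rewrite Fx coordinate0 fi =>
    /esym/eqP; rewrite expf_eq0 => /andP[].
have x0 i : parity i != d \/ is_f i -> coordinate e i x = 0.
  by move=> h; apply: xs; rewrite mem_enum inE negb_and negbK; apply/orP.
split.
  rewrite (coordinate_expand he x); apply: memv_suml => i _.
  have [<-|di] := eqVneq (parity i) d; first by rewrite memvZ // sb_graded.
  by rewrite x0 ?scale0r ?mem0v //; left.
rewrite (coordinate_expand he x) Frob_sum big1 // => i _; rewrite (sb_Frob he).
have p_gt0 := prime_gt0 (pcharf_prime hp).
case: ifP => fi; last by rewrite scaler0.
by rewrite x0 ?expr0n ?gtn_eqF ?scale0r //; right.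
Qed.

End Spans.

Lemma has_dim_inj (V : vectType k) (A : set V) m n :
  has_dim A m -> has_dim A n -> m = n.
Proof.
case=> [U [-> <-]] [U' [UU' <-]]; congr (\dim _); apply/vspaceP => x.
by apply/idP/idP => xU; move/(congr1 (fun B : set V => B x)): UU' => /=;
  [move=> <- | move=> ->].
Qed.

Definition bits (w : word l) : {set 'I_l} :=
  [set j : 'I_l | (tnth w j == Lv) (+) odd j].

(** [h j] is the only index of degree [d] at position [j]. For [d = 0] its vector is killed by [F]
    when [j] is a bit, for [d = 1] when [j] is not. *)
Lemma card_not_f d :
  #|[pred i | (parity i == d) && ~~ is_f i]| = if d then (l - #|bits w|)%N else
    #|bits w|.
Proof.
pose h (j : 'I_l) := (d (+) odd j, j).
have hi : injective h by move=> i j [].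
have -> : (if d then (l - #|bits w|)%N else #|bits w|)
    = #|[set j : 'I_l | (j \in bits w) (+) d]|.
  case: d {h hi}; last by apply: eq_card => j; rewrite !inE addbF.
  have E : (#|bits w| + #|~: bits w|)%N = l by rewrite cardsC card_ord.
  rewrite -[X in (X - _)%N]E addKn.
  by apply: eq_card => j; rewrite !inE addbT.
rewrite -(fintype.card_image hi); apply: eq_card => -[s j]; rewrite !inE /=.
apply/andP/fintype.imageP => [[/eqP di fi]|[j' h' [-> ->]]].
  exists j; last by rewrite /h -di /parity /= -addbA addbb addbF.
  by rewrite !inE -di /parity /=; move: fi; rewrite /is_f /= {di};
    case: (tnth w j) s (odd j) => [] [] [].
split; first by rewrite /parity /= -addbA addbb addbF.
by move: h'; rewrite !inE /is_f /=; case: (tnth w j') d {h hi} (odd j') => []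
  [] [].
Qed.

Lemma standard_signature M (e : bool * 'I_l -> M) :
  standard_basis e -> has_signature M ((l - #|bits w|)%N, #|bits w|).
Proof.
move=> he.
have key d : has_dim [set x : M | x \in graded M d /\ Frob x = 0]%classic
    (if d then (l - #|bits w|)%N else #|bits w|).
  eexists; split.
    by apply/seteqP; split => x /=; [apply: (kerFrobP he d x).1 | apply:
      (kerFrobP he d x).2].
  by rewrite (eqP (free_basis he (enum_uniq _))) size_map -cardE card_not_f.
by split; [apply: (key true) | apply: (key false)].
Qed.

Lemma has_signature_inj M s t : has_signature M s -> has_signature M t -> s = t.
Proof.
case: s t => [s1 s2] [t1 t2] [h1 h2] [h3 h4].
by congr (_, _); [apply: has_dim_inj h1 h3 | apply: has_dim_inj h2 h4].
Qed.

End Basis.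
End StandardBasis.

(** * Existence: a module with a standard basis for each word of even length *)

Section Construction.
Local Open Scope ring_scope.
Variables (k : closedFieldType) (p : nat).
Hypotheses (hp : p \in [pchar k]) (hp2 : (2 < p)%N).
Variables (l : nat) (w : word l).
Implicit Types (i j : bool * 'I_l).

Definition pred_idx i := (i.1, ord_pred i.2).

Lemma succ_idxK : cancel (@succ_idx l) pred_idx.
Proof. by case=> s j; rewrite /pred_idx /= ordSK. Qed.

Lemma pred_idxK : cancel pred_idx (@succ_idx l).
Proof. by case=> s j; rewrite /succ_idx /= ord_predK. Qed.

Lemma is_f_dual i : is_f w (dual_idx i) = ~~ is_f w i.
Proof. by rewrite /is_f /=; case: i => [] [] j; case: (tnth w j). Qed.

Definition std_carrier : vectType k := {ffun bool * 'I_l -> k^o}.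
Implicit Types x y : std_carrier.

Definition std_Frob x : std_carrier :=
  [ffun i => if is_f w (pred_idx i) then x (pred_idx i) ^+ p else 0].

Definition std_Ver x : std_carrier :=
  [ffun i => if is_f w i then 0 else proot hp (x (succ_idx i))].

Definition std_form x y : k :=
  \sum_(i : bool * 'I_l) (-1) ^+ i.1 * x i * y (dual_idx i).

Lemma std_form_linearl y : linear_for *%R (std_form ^~ y).
Proof.
move=> c x x'; rewrite /std_form mulr_sumr -big_split /=.
apply: eq_bigr => i _; rewrite !ffunE mulrDr mulrDl; congr (_ + _).
by rewrite !mulrA; congr (_ * _ * _); rewrite mulrC.
Qed.

Lemma std_form_linearr x : linear_for (idfun \; *%R) (std_form x).
Proof.
move=> c y y'; rewrite /std_form /= mulr_sumr -big_split /=.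
by apply: eq_bigr => i _; rewrite !ffunE mulrDr; congr (_ + _); apply: mulrCA.
Qed.

HB.instance Definition _ :=
  isBilinear.Build k std_carrier std_carrier k *%R (idfun \; *%R) std_form
    (fun y => zmod_morphism_linear (std_form_linearl y))
    (fun x => zmod_morphism_linear (std_form_linearr x))
    (fun y => scalable_linear (std_form_linearl y))
    (fun x => scalable_linear (std_form_linearr x)).

Lemma std_form_skew x y : std_form x y = (-1) ^+ true * idfun (std_form y x).
Proof.
rewrite /std_form mulr_sumr (reindex_inj (inv_inj (@dual_idxK l))).
apply: eq_bigr => i _; rewrite dual_idxK /= expr1 signrN !mulNr mul1r.
by rewrite mulrAC.
Qed.

HB.instance Definition _ :=
  isHermitianSesquilinear.Build k std_carrier true idfun std_form std_form_skew.


Definition std_pairing : {skew_symmetric std_carrier} := std_form.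

(** The coordinates of degree [d] are the ones erased, so that [std_gr d] can be defined as the
    kernel; the image lies in the other degree. *)
Definition std_proj (d : bool) x : std_carrier :=
  [ffun i => if parity i == d then 0 else x i].

Lemma std_proj_linear d : linear (std_proj d).
Proof.
move=> c x y; apply/ffunP => i; rewrite !ffunE.
by case: ifP; rewrite // scaler0 addr0.
Qed.

HB.instance Definition _ d :=
  GRing.isLinear.Build k std_carrier std_carrier *:%R (std_proj d)
    (std_proj_linear d).

Definition std_gr d : {vspace std_carrier} := lker (linfun (std_proj d)).

Lemma mem_std_grP d x :
  reflect (forall i, parity i != d -> x i = 0) (x \in std_gr d).
Proof.
rewrite memv_ker lfunE /=; apply: (iffP eqP) => [x0 i /negPf di|x0].
  by move/ffunP/(_ i): x0; rewrite !ffunE di.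
apply/ffunP => i; rewrite !ffunE.
by have [//|/x0] := eqVneq (parity i) d.
Qed.

Definition std_basis i : std_carrier := [ffun j => (i == j)%:R].

Lemma std_pairing_basisr x i : std_pairing x (std_basis i)
  = (-1) ^+ (~~ i.1) * x (dual_idx i).
Proof.
rewrite /std_pairing /= /std_form (bigD1 (dual_idx i)) //= big1 => [|j ji].
  by rewrite !ffunE dual_idxK eqxx mulr1 addr0.
by rewrite !ffunE -[i](@dual_idxK l) (inj_eq (inv_inj (@dual_idxK l))) eq_sym
  (negPf ji) mulr0.
Qed.

Lemma std_coordE x i : x i = (-1) ^+ i.1 * std_pairing x (std_basis (dual_idx
  i)).
Proof. by rewrite std_pairing_basisr dual_idxK /= negbK mulrA -signr_addb addbb
  mul1r. Qed.

Lemma std_basis_gr i : std_basis i \in std_gr (parity i).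
Proof.
apply/mem_std_grP => j; rewrite ffunE; case: (eqVneq i j) => // ->.
by rewrite eqxx.
Qed.

Lemma parity_dual i : parity (dual_idx i) = ~~ parity i.
Proof. by rewrite /parity /= addNb. Qed.

Let p_gt0 : (0 < p)%N. Proof. exact: ltnW (ltnW hp2). Qed.

Let exprpD (a b : k) : (a + b) ^+ p = a ^+ p + b ^+ p.
Proof. exact: (rmorphD (pFrobenius_aut hp)). Qed.

Let exprp_inj : injective (fun a : k => a ^+ p).
Proof. exact: (fmorph_inj (pFrobenius_aut hp)). Qed.

Let exprp0 : (0 : k) ^+ p = 0.
Proof. by rewrite expr0n gtn_eqF. Qed.

Let proot0 : proot hp 0 = 0.
Proof. by apply: exprp_inj; rewrite prootK exprp0. Qed.

Lemma std_Frob_lin : frobenius_linear p std_Frob.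
Proof.
split=> [x y|c x]; apply/ffunP => i; rewrite !ffunE; case: ifP => _.
- exact: exprpD.
- by rewrite addr0.
- exact: exprMn.
- by rewrite scaler0.
Qed.

Lemma std_Ver_lin : inv_frobenius_linear p std_Ver.
Proof.
split=> [x y|c x]; apply/ffunP => i; rewrite !ffunE; case: ifP => _.
- by rewrite addr0.
- by apply: exprp_inj; rewrite /= exprpD !prootK.
- by rewrite scaler0.
- apply: exprp_inj; rewrite prootK.
  by rewrite -[LHS]/(c ^+ p * x _) -[X in _ = X ^+ p]/(c * proot hp (x _))
    exprMn prootK.
Qed.

Lemma std_kerFrob x : std_Frob x = 0 <-> exists y, x = std_Ver y.
Proof.
split=> [/ffunP Fx|[y ->]].
  exists [ffun i => if is_f w (pred_idx i) then 0 else x (pred_idx i) ^+ p].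
  apply/ffunP => i; rewrite !ffunE succ_idxK; case: ifP => fi; last first.
    by rewrite fi; exact: (esym (expKproot hp (x i : k))).
  have := Fx (succ_idx i); rewrite !ffunE succ_idxK fi => /eqP.
  by rewrite expf_eq0 => /andP[_ /eqP].
by apply/ffunP => i; rewrite !ffunE; case: ifP => // fi; rewrite ?fi.
Qed.

Lemma std_kerVer x : std_Ver x = 0 <-> exists y, x = std_Frob y.
Proof.
split=> [/ffunP Vx|[y ->]].
  exists [ffun i => if is_f w i then proot hp (x (succ_idx i)) else 0].
  apply/ffunP => i; rewrite !ffunE pred_idxK; case: ifP => fi.
    by rewrite fi; exact: (esym (prootK hp (x i : k))).
  have := Vx (pred_idx i); rewrite !ffunE pred_idxK fi => /(congr1 (fun a :
    k => a ^+ p)).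
  by rewrite prootK exprp0.
apply/ffunP => i; rewrite !ffunE succ_idxK; case: ifP => // fi.
by rewrite fi proot0.
Qed.

Lemma std_pairing_FV x y :
  std_pairing (std_Frob x) y = std_pairing x (std_Ver y) ^+ p.
Proof.
rewrite /std_pairing /= /std_form (reindex_inj (@succ_idx_inj l)).
rewrite -[RHS]/(pFrobenius_aut hp _) rmorph_sum; apply: eq_bigr => i _.
rewrite !rmorphM rmorph_sign !ffunE succ_idxK is_f_dual.
case: (is_f w i); rewrite /= ?rmorph0 ?mulr0 ?mul0r //.
by congr (_ * _); rewrite pFrobenius_autE prootK.
Qed.

Lemma std_psymplectic : is_psymplectic std_pairing.
Proof.
split.
- rewrite /nondegenerate -subv0; apply/subvP => x /mem_orthovP x0.
  rewrite memv0; apply/eqP/ffunP => i.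
  by rewrite std_coordE x0 ?memvf // mulr0 ffunE.
- by split.
(* The last condition on a symplectic form concerns characteristic 2, which [2 < p] excludes. *)
- move=> h2; have := pcharf_eq hp => /(_ 2).
  rewrite h2 => /esym; rewrite inE => /eqP h; by move: hp2; rewrite -h.
Qed.

(** [dual_idx] reverses the degree. Hence two vectors of degree [d] are orthogonal, and the
    coordinates of the other degree are detected by pairing with basis vectors of degree [d]. *)
Lemma std_lagrangian d : lagrangian std_pairing (std_gr d).
Proof.
apply/vspaceP => x; apply/mem_orthovP/mem_std_grP => [x0 i di|x0 y /mem_std_grP
  y0].
  rewrite std_coordE x0 ?mulr0 //.
  have <- : parity (dual_idx i) = d; last exact: std_basis_gr.
  by rewrite parity_dual; case: (parity i) d {x0} di => [] [].
rewrite /std_pairing /= /std_form big1 // => i _.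
have [di|/x0 ->] := eqVneq (parity i) d; last by rewrite mulr0 mul0r.
by rewrite y0 ?mulr0 // parity_dual di; case: d {x0 y0 di}.
Qed.

Lemma std_gr_sum : (std_gr false + std_gr true)%VS = fullv.
Proof.
apply/eqP; rewrite eqEsubv subvf; apply/subvP => x _.
have -> : x = std_proj true x + std_proj false x.
  by apply/ffunP => i; rewrite !ffunE; case: (parity i); rewrite ?add0r ?addr0.
by apply: memv_add; apply/mem_std_grP => i; rewrite ffunE; case: (parity i).
Qed.

Lemma std_gr_direct : (std_gr false :&: std_gr true)%VS = 0%VS.
Proof.
apply/eqP; rewrite -subv0; apply/subvP => x; rewrite memv_cap memv0.
case/andP=> /mem_std_grP x0 /mem_std_grP x1; apply/eqP/ffunP => i.
rewrite ffunE; have [ti|fi] := boolP (parity i); first by rewrite x0 ?ti.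
by rewrite x1 // (negPf fi).
Qed.

Hypothesis leven : ~~ odd l.

(** The evenness of [l] makes the wrap from [l - 1] to 0 change parity as well, so that [F] and [V]
    exchange the two degrees. *)
Lemma odd_ordS (j : 'I_l) : odd (ordS j) = ~~ odd j.
Proof.
rewrite /=; have := ltn_ord j; rewrite leq_eqVlt => /orP[/eqP E|lt].
  by rewrite E modnn /=; move: (congr1 odd E) leven => /= -> /negPf ->.
by rewrite modn_small.
Qed.

Lemma parity_succ i : parity (succ_idx i) = ~~ parity i.
Proof. by rewrite /parity (odd_ordS i.2) addbN. Qed.

Lemma parity_pred i : parity (pred_idx i) = ~~ parity i.
Proof. by rewrite -[in RHS](pred_idxK i) parity_succ negbK. Qed.

Lemma std_Frob_gr d x : x \in std_gr d -> std_Frob x \in std_gr (~~ d).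
Proof.
move/mem_std_grP=> x0; apply/mem_std_grP => i di;
  rewrite ffunE x0 ?exprp0 ?if_same //.
by rewrite parity_pred; case: (parity i) d di {x0} => [] [].
Qed.

Lemma std_Ver_gr d x : x \in std_gr d -> std_Ver x \in std_gr (~~ d).
Proof.
move/mem_std_grP=> x0; apply/mem_std_grP => i di;
  rewrite ffunE x0 ?proot0 ?if_same //.
by rewrite parity_succ; case: (parity i) d di {x0} => [] [].
Qed.

Definition std_unitaryBT1 : unitaryBT1 k p :=
  UnitaryBT1 std_Frob_lin std_Ver_lin std_kerFrob std_kerVer std_psymplectic
    std_pairing_FV std_gr_sum std_gr_direct
    (@std_Frob_gr false) (@std_Frob_gr true)
    (@std_Ver_gr false) (@std_Ver_gr true)
    (std_lagrangian false) (std_lagrangian true).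

Lemma std_standard_basis : standard_basis w (M := std_unitaryBT1) std_basis.
Proof.
split.
- move=> x; exists x; apply/ffunP => i; rewrite sum_ffunE (bigD1 i) //= big1 =>
    [|j ji].
    by rewrite !ffunE eqxx addr0; apply/esym/mulr1.
  by rewrite !ffunE (negPf ji); apply: mulr0.
- move=> i; apply/ffunP => j; rewrite /= ffunE.
  have [<-|ij] := eqVneq (succ_idx i) j.
    by rewrite succ_idxK; case: ifP => _; rewrite !ffunE ?eqxx ?expr1n.
  have ij' : (i == pred_idx j) = false by apply: contraNF ij => /eqP ->;
    rewrite pred_idxK.
  by rewrite ffunE ij' exprp0 if_same; case: ifP; rewrite !ffunE ?(negPf ij).
- move=> i; apply/ffunP => j; rewrite /= !ffunE (inj_eq (@succ_idx_inj l)).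
  have [<-|ij] := eqVneq i j.
    case: ifP => _; rewrite !ffunE ?eqxx //.
    by apply: exprp_inj; rewrite prootK expr1n.
  by rewrite proot0 if_same; case: ifP; rewrite !ffunE ?(negPf ij).
- move=> i j; rewrite /= std_pairing_basisr ffunE; case: eqVneq => [->|_] /=.
    by rewrite mulr1.
  by rewrite mulr0.
- by move=> i; have := std_basis_gr i; rewrite /graded; case: (parity i).
Qed.

End Construction.

(** * Standard bases and [is_Mtilde] express the same structure *)

Section Mtilde.
Local Open Scope ring_scope.
Variables (k : closedFieldType) (p : nat).
Hypothesis hp : p \in [pchar k].
Implicit Types M N : unitaryBT1 k p.
Variable l : nat.
Implicit Type w : word l.

Lemma Mtilde_standard_basis w M :
  is_Mtilde w M -> exists e : bool * 'I_l -> M, standard_basis w e.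
Proof.
case=> a [b [hab [actA actB] pairs g0 g1]].
pose e (i : bool * 'I_l) := if i.1 then b i.2 else a i.2.
exists e; split.
- move=> x.
  have: x \in (\sum_i <[e i]>)%VS.
    have: x \in <<codom a ++ codom b>>%VS by rewrite (span_basis hab) memvf.
    apply/subvP/span_subvP => y; rewrite mem_cat.
    case/orP=> /codomP[j ->].
      by apply: (subvP (sumv_sup (false, j) isT (subvv _))); apply: memv_line.
    by apply: (subvP (sumv_sup (true, j) isT (subvv _))); apply: memv_line.
  case/memv_sumP => v hv ->.
  have /choice[c hc] : forall i, exists c, v i = c *: e i.
    by move=> i; apply/vlineP/hv.
  by exists c; apply: eq_bigr.
- case=> [] [] j; rewrite /e /is_f /=.
    have [-> _] := actB j; rewrite tnth_map.
    by case: (tnth w j).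
  by have [-> _] := actA j.
- case=> [] [] j; rewrite /e /is_f /=.
    have [_ ->] := actB j; rewrite tnth_map.
    by case: (tnth w j).
  by have [_ ->] := actA j; case: (tnth w j).
- move=> [s i] [t j]; have [ab aa _] := pairs i j.
  have [ba _ bb] := pairs j i.
  case: s t => [] []; rewrite /e xpair_eqE /=.
  + by have [_ _ ->] := pairs i j.
  (* The form is prescribed on pairs [(a_i, b_j)]; skew-symmetry supplies the sign on
     [(b_i, a_j)]. *)
  + by rewrite hermC ba /= expr1 mulN1r eq_sym; case: eqP; rewrite // oppr0.
  + by rewrite ab; case: eqP.
  + exact: aa.
- case=> [] [] j; rewrite /e /parity /graded /= ?g0 ?g1.
    case oj: (odd j); rewrite /= ?g0 ?g1 memv_span // mem_cat map_f ?orbT //.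
      by rewrite mem_filter oj mem_enum.
    by rewrite mem_filter oj mem_enum.
  case oj: (odd j); rewrite /= ?g0 ?g1 memv_span // mem_cat map_f ?orbT //.
    by rewrite mem_filter oj mem_enum.
  by rewrite mem_filter oj mem_enum.
Qed.

Lemma graded_span w M (e : bool * 'I_l -> M) d (s : seq (bool * 'I_l)) :
  standard_basis w e -> (forall i, (i \in s) = (parity i == d)) ->
  graded M d = <<[seq e i | i <- s]>>%VS.
Proof.
move=> he sd; apply/vspaceP => x; apply/idP/(mem_basis_spanP he) => [xd i|x0].
  by rewrite sd; apply: (coordinate_graded he xd).
rewrite (coordinate_expand he x); apply: memv_suml => i _.
have [<-|di] := eqVneq (parity i) d; first by rewrite memvZ // (sb_graded he).
by rewrite x0 ?scale0r ?mem0v // sd.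
Qed.

Lemma standard_basis_Mtilde w M (e : bool * 'I_l -> M) :
  standard_basis w e -> is_Mtilde w M.
Proof.
move=> he; pose a j := e (false, j); pose b j := e (true, j).
have mapE (s t : seq 'I_l) : [seq a j | j <- s] ++ [seq b j | j <- t]
    = [seq e i | i <- [seq (false, j) | j <- s] ++ [seq (true, j) | j <- t]].
  by rewrite map_cat -!map_comp.
have pairI s (t : seq 'I_l) i : (i \in [seq (s, j) | j <- t])
  = (i.1 == s) && (i.2 \in t).
  case: i => s' j /=; apply/mapP/andP => [[j' jt [-> ->]] //|[/eqP -> jt]].
  by exists j.
have uniqI (s t : seq 'I_l) : uniq s -> uniq t ->
    uniq ([seq (false, j) | j <- s] ++ [seq (true, j) | j <- t]).
  move=> us ut; rewrite cat_uniq !map_inj_uniq ?us ?ut; try by move=> ? ? [].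
  by rewrite andbT; apply/hasPn => i; rewrite /= !pairI => /andP[/eqP -> _].
have gr d s t : (forall j : 'I_l, (j \in s) = (odd j == d)) ->
    (forall j : 'I_l, (j \in t) = (odd j == ~~ d)) ->
    graded M d = <<[seq a j | j <- s] ++ [seq b j | j <- t]>>%VS.
  move=> hs ht; rewrite mapE; apply: (graded_span he) => -[s' j].
  rewrite mem_cat !pairI /= hs ht /parity /=.
  by case: s' (odd j) d {hs ht} => [] [] [].
exists a, b; split.
- rewrite /codom /image_mem mapE /basis_of eqEsubv subvf.
  rewrite (basis_spanf he) ?(free_basis he) //.
  + by apply: uniqI; apply: enum_uniq.
  + move=> [s j]; rewrite mem_cat !pairI /= !mem_enum.
    by case: s.
- split=> j; split.
  + exact: (sb_Frob he (false, j)).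
  + rewrite [LHS](sb_Ver he (false, j)) /is_f /=.
    by case: (tnth w j).
  + rewrite [LHS](sb_Frob he (true, j)) /is_f /= tnth_map.
    by case: (tnth w j).
  + rewrite [LHS](sb_Ver he (true, j)) /is_f /= tnth_map.
    by case: (tnth w j).
- move=> i j; rewrite /a /b !(sb_pairing he) !xpair_eqE /=; split=> //.
  by case: eqP.
- by apply: (gr false) => j; rewrite mem_filter mem_enum andbT; case: (odd j).
- by apply: (gr true) => j; rewrite mem_filter mem_enum andbT; case: (odd j).
Qed.

End Mtilde.

(** * Bicycles are isomorphic only within an orbit *)

Definition twist (l : nat) (w : word l) : word l := dual (tau w).

Lemma val_iter_ordS l (j : 'I_l) n : iter n (@ordS l) j
  = ((j + n) %% l)%N :> nat.
Proof.
elim: n => [|n IH]; first by rewrite addn0 modn_small.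
by rewrite iterS /= IH -addn1 modnDml addn1 addnS.
Qed.

Lemma tnth_tau l (w : word l) j : tnth (tau w) j = tnth w (ordS j).
Proof.
rewrite !(tnth_nth Lf) /=; case: l w j => [|l] w j; first by case: j.
rewrite /rot nth_cat size_drop size_tuple nth_drop subn1 add1n /=.
have := ltn_ord j; rewrite ltnS leq_eqVlt => /orP[/eqP ->|jl].
  by rewrite ltnn subnn modnn nth_take.
by rewrite jl modn_small.
Qed.

Lemma tnth_twist l (w : word l) j :
  tnth (twist w) j = dual_letter (tnth w (ordS j)).
Proof. by rewrite tnth_map tnth_tau. Qed.

Lemma twist_inj l : injective (@twist l).
Proof.
move=> w w' E; apply: eq_from_tnth => j.
have := congr1 (fun u => tnth u (ord_pred j)) E.
by rewrite /= !tnth_twist ord_predK; case: (tnth w j); case: (tnth w' j).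
Qed.

Lemma is_f_twist l (w : word l) i :
  is_f (twist w) i = is_f w (~~ i.1, ordS i.2).
Proof. by case: i => [] [] j; rewrite /is_f /= tnth_twist;
  case: (tnth _ _). Qed.

Lemma is_f_iter_twist l (w : word l) n i :
  is_f (iter n (@twist l) w) i = is_f w (i.1 (+) odd n, iter n (@ordS l) i.2).
Proof.
elim: n i => [|n IH] i; first by rewrite addbF; case: i.
by rewrite iterS is_f_twist IH /= addbN addNb -iterSr.
Qed.

Section Twist.
Local Open Scope ring_scope.
Variables (k : closedFieldType) (p : nat).
Hypothesis hp : p \in [pchar k].
Implicit Types M N : unitaryBT1 k p.
Variable l : nat.
Hypothesis leven : ~~ odd l.
Implicit Types w : word l.

Lemma FrobN M (x : M) : Frob (- x) = - Frob x.
Proof.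
have [FD _] := Frob_lin M; apply: (addrI (Frob x)).
by rewrite -FD !subrr Frob0.
Qed.

Lemma VerN M (x : M) : Ver (- x) = - Ver x.
Proof.
have [VD _] := Ver_lin M; have V0 : Ver (0 : M) = 0.
  by apply: (addrI (Ver 0)); rewrite -VD !addr0.
by apply: (addrI (Ver x)); rewrite -VD !subrr.
Qed.

(* Exchanging the two cycles and turning by one step restores the grading; the
   sign keeps the pairing. *)
Lemma standard_basis_twist w M (e : bool * 'I_l -> M) :
  standard_basis w e ->
  standard_basis (twist w) (fun i => (-1) ^+ i.1 *: e (~~ i.1, ordS i.2)).
Proof.
move=> he; pose h i : bool * 'I_l := (~~ i.1, ordS i.2).
have h_inj : injective h.
  move=> [s i] [t j] E; have /= /negb_inj -> := congr1 fst E.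
  by have /= -> := ordS_inj (congr1 snd E).
have FS (b : bool) (x : M) : Frob ((-1) ^+ b *: x) = (-1) ^+ b *: Frob x.
  by case: b; rewrite ?scale1r // expr1 !scaleN1r FrobN.
have VS (b : bool) (x : M) : Ver ((-1) ^+ b *: x) = (-1) ^+ b *: Ver x.
  by case: b; rewrite ?scale1r // expr1 !scaleN1r VerN.
split.
- move=> x; have [c ->] := sb_span he x.
  exists (fun i => c (h i) * (-1) ^+ i.1).
  rewrite (reindex_inj h_inj); apply: eq_bigr => i _.
  by rewrite scalerA -mulrA -signr_addb addbb mulr1.
- move=> i; rewrite FS (sb_Frob he) is_f_twist.
  by case: ifP => _; rewrite ?scaler0.
- move=> i; rewrite VS is_f_twist.
  rewrite [X in _ *: X](sb_Ver he (~~ i.1, ordS i.2)).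
  by case: ifP => _; rewrite ?scaler0.
- move=> i j; rewrite linearZl_LR linearZr_LR /= (sb_pairing he) /=.
  have -> : ((~~ i.1, ordS i.2) == dual_idx (~~ j.1, ordS j.2))
    = (i == dual_idx j).
    by rewrite -[_ == _]/(h i == h (dual_idx j)) (inj_eq h_inj).
  case: eqP => [->|_]; last by rewrite !mulr0.
  by rewrite /=; case: j.1; rewrite /= ?expr0 ?expr1 ?mul1r ?mulr1 ?mulrN1
    ?opprK.
- move=> i; rewrite memvZ //.
  have -> : parity i = parity (h i) by rewrite /parity (odd_ordS leven i.2)
    addbN addNb negbK.
  exact: (sb_graded he).
Qed.

Lemma standard_basis_orbit w w' M (e : bool * 'I_l -> M) :
  standard_basis w e -> fconnect (@twist l) w w' ->
  exists e' : bool * 'I_l -> M, standard_basis w' e'.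
Proof.
move=> he /iter_findex <-; elim: (findex _ _ _) => [|n [e' he']];
  first by exists e.
by eexists; rewrite iterS; apply: standard_basis_twist he'.
Qed.

Definition lexle w w' : bool :=
  ((map bool_of_letter w : seqlexi bool) <= map bool_of_letter w' :> seqlexi
    bool)%O.

(** The hypothesis bears only on positions before which the words agree; at the first difference it
    leaves [f] in [w] against [v] in [w']. *)
Lemma lexleP w w' :
  (forall n, (n < l)%N -> (forall m, (m < n)%N -> nth Lf w m = nth Lf w' m) ->
     nth Lf w' n = Lf -> nth Lf w n = Lf) ->
  lexle w w'.
Proof.
rewrite /lexle -{1}(size_tuple w); have := etrans (size_tuple w) (esym
  (size_tuple w')).
elim: {w w'}(val w) (val w') => [|u s IH] [|v t] //= [st] H.
have H0 : v = Lf -> u = Lf by apply: (H 0).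
rewrite lexi_cons; apply/andP; split.
  by case: u v H0 {H} => [] [] // /(_ erefl).
apply/implyP => vu; apply: IH => // n ns E; apply: (H n.+1 ns) => -[_|m].
  by case: u v vu H0 {H E} => [] [] // _ /(_ erefl).
exact: E.
Qed.

Lemma lexle_anti w w' : lexle w w' -> lexle w' w -> w = w'.
Proof.
move=> h1 h2; apply: val_inj; apply: (inj_map (can_inj bool_of_letterK)).
by apply: (@Order.POrderTheory.le_anti _ (seqlexi bool)); apply/andP.
Qed.

Hypothesis lgt0 : (0 < l)%N.

(** At the first difference, [v] in [w'] against [f] at the support index is contradictory: the
    image would lie in the image of [V], which has no component there. The opposite difference is
    harmless, because [F] kills that component. Hence an order between words instead of an
    equality. *)
Lemma morphism_lexle w w' M N (e : bool * 'I_l -> M) (e' : bool * 'I_l -> N)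
    (phi : 'Hom(N, M)) :
  standard_basis w e -> standard_basis w' e' -> injective phi ->
  (forall x, phi (Frob x) = Frob (phi x)) ->
  (forall x, phi (Ver x) = Ver (phi x)) ->
  (phi @: gr0 N = gr0 M)%VS ->
  exists2 w1, fconnect (@twist l) w w1 & lexle w' w1.
Proof.
move=> he he' phi_inj phiF phiV phi0.
pose z : bool * 'I_l := (false, Ordinal lgt0).
pose x n := phi (e' (iter n (@succ_idx l) z)).
have [i0 ci0 di0] : exists2 i0, coordinate e i0 (x 0) != 0 & ~~ parity i0.
  have x0gr : x 0 \in graded M false.
    by rewrite /graded -phi0 memv_img // (sb_graded he' z).
  have [/existsP[i ci]|] := boolP [exists i, coordinate e i (x 0) != 0].
    exists i => //; apply: contraNN ci => di.
    by rewrite (coordinate_graded he x0gr) // di.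
  rewrite negb_exists => /forallP c0.
  have x0 : x 0 = phi 0.
    rewrite linear0 (coordinate_expand he (x 0)) big1 // => i _.
    by have := c0 i; rewrite negbK => /eqP ->; rewrite scale0r.
  have := coordinate_basis he' z z; rewrite (phi_inj _ _ x0) coordinate0 eqxx.
  by move/esym/eqP; rewrite oner_eq0.
(* Since [i0] has degree 0, its first component is the parity of [i0.2]; so [i0.2] twists turn the
   path starting at [i0] into the one starting at [z]. *)
pose W := iter i0.2 (@twist l) w.
exists W; first exact: fconnect_iter.
pose zn n := iter n (@succ_idx l) z; pose i_ n := iter n (@succ_idx l) i0.
have iter_succ n i : iter n (@succ_idx l) i = (i.1, iter n (@ordS l) i.2).
  by elim: n => [|n IH]; [case: i | rewrite iterS IH].
have W_f n : is_f W (zn n) = is_f w (i_ n).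
  rewrite is_f_iter_twist /zn /i_ !iter_succ /=.
  congr (is_f _ (_, _)).
    by move: di0; rewrite /parity; case: i0.1; case: (odd _).
  rewrite -iterD addnC iterD; congr iter; apply: val_inj.
  by rewrite [LHS]val_iter_ordS add0n modn_small.
have nthE (u : word l) n : (n < l)%N -> (nth Lf u n == Lf) = is_f u (zn n).
  move=> nl; rewrite /is_f /zn iter_succ /= (tnth_nth Lf).
  by rewrite val_iter_ordS add0n modn_small.
have cx n : (n <= l)%N -> (forall m, (m < n)%N -> nth Lf w' m = nth Lf W m) ->
    coordinate e (i_ n) (x n) != 0.
  elim: n => [//|n IH] nl E.
  have {}IH := IH (ltnW nl) (fun m mn => E m (ltnW mn)).
  have Efn : is_f w' (zn n) = is_f w (i_ n).
    by rewrite -W_f -!nthE // E.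
  rewrite /i_ iterS -/(i_ n).
  have [fn|fn] := boolP (is_f w (i_ n)).
    have -> : x n.+1 = Frob (x n) by rewrite -phiF (sb_Frob he') Efn fn.
    by rewrite (coordinate_Frob he) fn expf_neq0.
  (* Along a letter [v] the path is followed backwards: if [x n.+1] had no component at the next
     index, [x n = V (x n.+1)] would have none at [i_ n]. *)
  have xV : x n = Ver (x n.+1).
    by rewrite -phiV (sb_Ver he') Efn (negPf fn).
  apply: contraNneq IH => c0; apply/eqP.
  have := coordinate_Ver hp he (i_ n) (x n.+1).
  rewrite c0 if_same -xV => /eqP; rewrite expf_eq0 => /andP[_ /eqP //].
apply: lexleP => n nl E /eqP; rewrite nthE // W_f => fn.
apply/eqP; rewrite nthE //; apply: contraNT (cx n (ltnW nl) E) => fn'.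
have xV : x n = Ver (x n.+1) by rewrite -phiV (sb_Ver he') (negPf fn').
have := coordinate_Ver hp he (i_ n) (x n.+1).
by rewrite fn -xV => /eqP; rewrite expf_eq0 => /andP[].
Qed.

Lemma isomorphic_sym M N : isomorphic M N -> isomorphic N M.
Proof.
case=> phi [[psi phiK psiK] phiF phiV phiP [phi0 phi1]].
have psi_lin : linear psi.
  by move=> c x y; apply: (can_inj phiK); rewrite linearP /= !psiK.
pose f : {linear N -> M} := HB.pack psi (GRing.isLinear.Build _ _ _ _ _
  psi_lin).
exists (linfun f).
have gr U V : (phi @: U = V)%VS -> (linfun f @: V)%VS = U.
  move=> <-; apply/vspaceP => x; apply/memv_imgP/idP.
    by case=> _ /memv_imgP[y yU ->] ->; rewrite lfunE /= phiK.
  by move=> xU; exists (phi x); rewrite ?memv_img // lfunE /= phiK.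
split; last by split; apply: gr.
- by exists phi => x; rewrite lfunE /=.
- by move=> x; rewrite !lfunE /=; apply: (can_inj phiK); rewrite phiF !psiK.
- by move=> x; rewrite !lfunE /=; apply: (can_inj phiK); rewrite phiV !psiK.
- by move=> x y; rewrite !lfunE /= -phiP !psiK.
Qed.

Lemma isomorphic_trans M N L : isomorphic M N -> isomorphic N L ->
  isomorphic M L.
Proof.
case=> phi [phib phiF phiV phiP [phi0 phi1]].
case=> psi [psib psiF psiV psiP [psi0 psi1]].
exists (psi \o phi)%VF; split; last by rewrite !limg_comp phi0 phi1.
- have [f fK Kf] := phib; have [g gK Kg] := psib.
  by exists (f \o g) => x; rewrite comp_lfunE /= ?gK ?fK ?Kf ?Kg.
- by move=> x; rewrite !comp_lfunE phiF psiF.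
- by move=> x; rewrite !comp_lfunE phiV psiV.
- by move=> x y; rewrite !comp_lfunE psiP phiP.
Qed.

Lemma isomorphic_orbit_lexle w w' M N (e : bool * 'I_l ->
  M) (e' : bool * 'I_l -> N) :
  standard_basis w e -> standard_basis w' e' -> isomorphic N M ->
  forall w1, fconnect (@twist l) w' w1 ->
  exists2 w2, fconnect (@twist l) w w2 & lexle w1 w2.
Proof.
move=> he he' [phi [phib phiF phiV _ [phi0 _]]] w1 /(standard_basis_orbit
  he')[e1 he1].
exact: (morphism_lexle he he1 (bij_inj phib) phiF phiV phi0).
Qed.

Lemma isomorphic_fconnect w w' M N (e : bool * 'I_l ->
  M) (e' : bool * 'I_l -> N) :
  standard_basis w e -> standard_basis w' e' -> isomorphic M N ->
  fconnect (@twist l) w w'.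
Proof.
move=> he he' iso.
have le1 := isomorphic_orbit_lexle he he' (isomorphic_sym iso).
have le2 := isomorphic_orbit_lexle he' he iso.
pose key (u : word l) : seqlexi bool := map bool_of_letter u.
(* With [a] maximal in the orbit of [w'], some [b] in the orbit of [w] and some [c] in that of [w']
   satisfy [a <= b <= c <= a]. *)
have [a wa amax] := Order.TotalTheory.arg_maxP key (connect0 (frel (@twist l))
  w').
have [b wb ab] := le1 a wa.
have [c wc bc] := le2 b wb.
have ca : lexle c a := amax c wc.
have {}ab : a = b by apply: lexle_anti ab (Order.POrderTheory.le_trans bc ca).
apply: connect_trans wb _; rewrite -ab.
by rewrite (fconnect_sym (@twist_inj l)).
Qed.

End Twist.

(** * Orbits of words *)

Lemma mobius_mul_prime_coprime p m :
  prime p -> (0 < m)%N -> ~~ (p %| m) -> mobius (p * m) = (- mobius m)%R.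
Proof.
move=> pr m0 pm; have p0 := prime_gt0 pr.
have prs : perm_eq (primes (p * m)) (p :: primes m).
  apply: uniq_perm; rewrite /= ?primes_uniq ?andbT //.
    by rewrite mem_primes (negPf pm) !andbF.
  by move=> r; rewrite primesM // inE primes_prime // mem_seq1.
rewrite /mobius (perm_all _ prs) (perm_size prs) /=.
have -> : logn p (p * m) == 1.
  by rewrite lognM // logn_prime // eqxx lognE (negPf pm) !andbF.
have -> : all (fun r => logn r (p * m) == 1) (primes m)
    = all (fun r => logn r m == 1) (primes m).
  apply: eq_in_all => r; rewrite mem_primes => /and3P[rp _ rm].
  rewrite lognM // logn_prime //; have [rE|//] := eqVneq r p.
  by rewrite -rE rm in pm.
rewrite andTb; case: ifP => _; last by rewrite oppr0.
by rewrite exprS mulN1r.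
Qed.

Lemma mobius_mul_prime_dvd p m :
  prime p -> (0 < m)%N -> p %| m -> mobius (p * m) = 0%R.
Proof.
move=> pr m0 pm; have p0 := prime_gt0 pr.
rewrite /mobius; case: allP => // /(_ p); rewrite mem_primes pr muln_gt0 p0 m0.
rewrite dvdn_mulr // => /(_ isT); rewrite lognM // logn_prime // eqxx.
have : (0 < logn p m)%N by rewrite logn_gt0 mem_primes pr m0.
by case: (logn p m).
Qed.

Lemma big_divisors (R : nmodType) (m n : nat) (P Q : pred nat) (F : nat -> R) :
  (0 < m)%N -> (0 < n)%N ->
  (forall d, (d %| m)%N && P d = (d %| n)%N && Q d) ->
  (\sum_(d <- divisors m | P d) F d = \sum_(d <- divisors n | Q d) F d)%R.
Proof.
move=> m0 n0 PQ; rewrite -!(big_filter (divisors _)); apply: perm_big.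
apply: uniq_perm; rewrite ?filter_uniq ?divisors_uniq // => d.
by rewrite !mem_filter -!dvdn_divisors // andbC PQ andbC.
Qed.

Lemma sum_mobius n :
  (0 < n)%N -> (\sum_(d <- divisors n) mobius d = (n == 1)%:R)%R.
Proof.
move=> n0; have [->|n1] := eqVneq n 1; first by rewrite big_seq1.
have n_gt1 : (1 < n)%N by rewrite ltn_neqAle eq_sym n1.
have pr := pdiv_prime n_gt1; set p := pdiv n in pr.
have p0 := prime_gt0 pr.
have [m nE] : exists m, n = (p * m)%N.
  by have /dvdnP[m ->] := pdiv_dvd n; exists m; rewrite mulnC.
have m0 : (0 < m)%N by move: n0; rewrite nE muln_gt0 => /andP[].
(* The terms of [d] and [p * d], for [d] prime to [p], cancel. *)
rewrite (bigID (fun d => p %| d)) /=.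
have -> : (\sum_(d <- divisors n | (p %| d)%N) mobius d
    = \sum_(d <- divisors m) mobius (p * d)%N)%R.
  rewrite -big_filter -(big_map (muln p) xpredT mobius).
  apply: perm_big; apply: uniq_perm.
  - by rewrite filter_uniq ?divisors_uniq.
  - rewrite map_inj_uniq ?divisors_uniq // => a b /eqP.
    by rewrite eqn_pmul2l // => /eqP.
  - move=> d; rewrite mem_filter -dvdn_divisors // nE.
    apply/andP/mapP => [[/dvdnP[c ->]]|[c cm ->]].
      rewrite mulnC dvdn_pmul2l // => cm.
      by exists c => //; rewrite -dvdn_divisors.
    by rewrite dvdn_mulr // dvdn_pmul2l // dvdn_divisors.
rewrite (bigID (fun d => p %| d)) /= big_seq_cond big1 => [|d]; last first.
  rewrite -dvdn_divisors // => /andP[dm pd].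
  by rewrite mobius_mul_prime_dvd // (dvdn_gt0 m0).
rewrite add0r (big_divisors (n := n) (Q := fun d => ~~ (p %| d))) // => [|d].
  rewrite -big_split /= big_seq_cond big1 // => d.
  rewrite -dvdn_divisors // => /andP[dn pd].
  by rewrite mobius_mul_prime_coprime ?(dvdn_gt0 n0) // addNr.
have [//|pd] := boolP (p %| d); first by rewrite !andbF.
by rewrite !andbT nE Gauss_dvdr // coprime_sym prime_coprime.
Qed.

Lemma iter_fixP (T : finType) (f : T -> T) (x : T) n :
  injective f -> (iter n f x == x) = (order f x %| n).
Proof.
move=> fI; have per m : iter (m * order f x) f x = x.
  by elim: m => // m IH; rewrite mulSn iterD IH iter_order.
apply/eqP/idP => [E|/dvdnP[m ->]]; last exact: per.
have r_lt : (n %% order f x < order f x)%N by rewrite ltn_mod order_gt0.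
have : iter (n %% order f x) f x = x.
  by rewrite -[in RHS]E {2}(divn_eq n (order f x)) addnC iterD per.
by move/(congr1 (findex f x)); rewrite findex_iter // findex0 => /eqP.
Qed.

(** * Rotation, primitivity and self-duality *)

Section Words.
Variable q : nat.
Implicit Types (w : word q) (j : 'I_q).

Lemma tau_inj : injective (@tau q).
Proof.
move=> w w' E; apply: eq_from_tnth => j.
have := congr1 (fun u => tnth u (ord_pred j)) E.
by rewrite /= !tnth_tau ord_predK.
Qed.

Lemma dual_inj : injective (@dual q).
Proof.
move=> w w' E; apply: eq_from_tnth => j.
have := congr1 (fun u => tnth u j) E.
by rewrite /= !tnth_map; case: (tnth w j); case: (tnth w' j).
Qed.

Lemma dualK : involutive (@dual q).
Proof. by move=> w; apply: eq_from_tnth => j; rewrite !tnth_map;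
  case: (tnth w j). Qed.

Lemma dual_tau w : dual (tau w) = tau (dual w).
Proof. by apply: eq_from_tnth => j; rewrite !(tnth_map, tnth_tau). Qed.

Lemma dual_iter_tau n w : dual (iter n (@tau q) w) = iter n (@tau q) (dual w).
Proof. by elim: n => //= n IH; rewrite dual_tau IH. Qed.

Lemma tnth_iter_tau n w j :
  tnth (iter n (@tau q) w) j = tnth w (iter n (@ordS q) j).
Proof. by elim: n j => // n IH j; rewrite iterS tnth_tau IH -iterSr. Qed.

Lemma iter_ordSq j : iter q (@ordS q) j = j.
Proof. by apply: val_inj; rewrite [LHS]val_iter_ordS modnDr modn_small. Qed.

Lemma iter_tauq w : iter q (@tau q) w = w.
Proof. by apply: eq_from_tnth => j; rewrite tnth_iter_tau iter_ordSq. Qed.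

Lemma order_tau_dvd w : order (@tau q) w %| q.
Proof. by rewrite -(iter_fixP _ _ tau_inj) iter_tauq. Qed.

Lemma val_iter_tau n w : (n <= q)%N -> iter n (@tau q) w
  = rot n w :> seq letter.
Proof.
elim: n => [|n IH] nq; first by rewrite rot0.
have -> : val (iter n.+1 (@tau q) w) = rot 1 (iter n (@tau q) w) by [].
by rewrite (IH (ltnW nq)) -(@rotD _ 1) ?add1n // size_tuple.
Qed.

Hypothesis q0 : (0 < q)%N.

(** If the rotation order [o] of [w] is smaller than [q], then [w] is [o]-periodic and [o] divides
    [q], so [w] repeats its first [o] letters. Conversely, a repetition of [s] is fixed by rotating
    [size s < q] times. *)
Lemma primitiveP w : primitive w <-> order (@tau q) w = q.
Proof.
split=> [prim|ordq n s n1 sq wE].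
  have /dvdnP[n qE] := order_tau_dvd w; set o := order _ w in qE *.
  apply/eqP; apply: contraT => oq.
  have o_gt0 : (0 < o)%N by rewrite order_gt0.
  have o_lt : (o < q)%N by rewrite ltn_neqAle oq dvdn_leq ?order_tau_dvd.
  have n1 : (1 < n)%N.
    by case: n qE => [|[|n]] // qE; rewrite qE ?mul1n ?ltnn // in o_lt.
  have so : size (take o w) = o by rewrite size_take size_tuple o_lt.
  case: (prim n (take o w) n1); first by rewrite so.
  have wr : rot o w = w.
    by rewrite -val_iter_tau ?(ltnW o_lt) // iter_order //; apply: tau_inj.
  have shift i : (i + o < q)%N -> nth Lf w (i + o) = nth Lf w i.
    move=> io; rewrite -[in RHS]wr /rot nth_cat size_drop size_tuple.
    by rewrite ltn_subRL (addnC o i) io nth_drop (addnC o i).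
  have nth_per m r : (r < o)%N -> (m * o + r < q)%N ->
    nth Lf w (m * o + r) = nth Lf w r.
    move=> ro; elim: m => // m IH mq.
    rewrite mulSn -addnA addnC shift ?IH //.
      by apply: leq_ltn_trans mq; rewrite mulSn -addnA leq_addl.
    by rewrite addnC addnA -mulSn.
  have nth_flat (s : seq letter) m i : (i < m * size s)%N ->
      nth Lf (flatten (nseq m s)) i = nth Lf s (i %% size s).
    elim: m i => // m IH i im; rewrite /= nth_cat.
    have [is_|is_] := ltnP i (size s); first by rewrite modn_small.
    rewrite IH; last by rewrite ltn_subLR // -mulSn.
    by rewrite -{2}(subnK is_) modnDr.
  apply: (@eq_from_nth _ Lf) => [|i].
    by rewrite size_flatten /shape map_nseq sumn_nseq so size_tuple mulnC.
  rewrite size_tuple => iq; rewrite nth_flat so -?qE // nth_take ?ltn_mod //.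
  by rewrite {1}(divn_eq i o) nth_per ?ltn_mod // -divn_eq.
have sw : q = (n * size s)%N.
  by rewrite -(size_tuple w) wE size_flatten /shape map_nseq sumn_nseq mulnC.
have s0 : (0 < size s)%N by move: q0; rewrite sw muln_gt0 => /andP[].
suff : q %| size s by move/(dvdn_leq s0); rewrite leqNgt sq.
rewrite -{1}ordq -(iter_fixP _ _ tau_inj); apply/eqP/val_inj.
rewrite /= (val_iter_tau _ (ltnW sq)) wE; case: n n1 {wE sw} => // n _.
rewrite [flatten _]/= rot_size_cat.
by elim: n => [|n IH] /=; rewrite ?cats0 // -catA IH.
Qed.

(** If [tau^n w] is the dual of [w], then [tau^(2n) w = w], so [q] divides [2n] and [n] is 0 or
    [q / 2] modulo [q]. The value 0 is impossible, as no letter is its own dual. *)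
Lemma self_dual_primitiveP w : ~~ odd q -> primitive w ->
  self_dual w <-> iter q./2 (@tau q) w = dual w.
Proof.
move=> qe /primitiveP ordq; split=> [[n dw]|E]; last by exists q./2.
have q2 : q = q./2.*2 by rewrite even_halfK.
have : q %| n.*2.
  rewrite -{1}ordq -(iter_fixP _ _ tau_inj) -addnn iterD -dw -dual_iter_tau -dw.
  by rewrite dualK.
rewrite {1}q2 -!muln2 dvdn_pmul2r // => /dvdnP[m nE].
have E : dual w = iter (odd m * q./2) (@tau q) w.
  have mE : n = (odd m * q./2 + m./2 * q)%N.
    rewrite nE -{1}(odd_double_half m) mulnDl; congr (_ + _).
    by rewrite [in RHS]q2 -!muln2 -mulnA (mulnC 2).
  rewrite dw mE iterD; congr iter.
  by apply/eqP; rewrite (iter_fixP _ _ tau_inj) ordq dvdn_mull.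
rewrite E; case: (odd m) E => [|/= E]; first by rewrite mul1n.
have := congr1 (fun u => tnth u (Ordinal q0)) E.
by rewrite tnth_map; case: (tnth w _).
Qed.

End Words.

Lemma big_nat_double (F : nat -> nat) n :
  \sum_(0 <= j < n.*2) F j
    = \sum_(0 <= j < n) F (2 * j) + \sum_(0 <= j < n) F (2 * j).+1.
Proof.
elim: n => [|n IH]; first by rewrite !big_geq.
rewrite doubleS !big_nat_recr //= IH mul2n.
by rewrite -!addnA; congr (_ + _); rewrite addnCA.
Qed.

(** * Bits, and the size of the orbits under [twist] *)

Section Bits.
Variable q : nat.
Hypotheses (q0 : (0 < q)%N) (qe : ~~ odd q).
Implicit Types (w : word q) (j : 'I_q) (A : {set 'I_q}).

Lemma delta0_bits w : delta0 w = #|bits w|.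
Proof.
pose F (j : nat) : nat := (nth Lf w j == Lv) (+) odd j.
have -> : #|bits w| = \sum_(0 <= j < q) F j.
  rewrite big_mkord -sum1_card big_mkcond /=; apply: eq_bigr => j _.
  by rewrite inE /F (tnth_nth Lf); case: (_ (+) _).
have q2 : q = q./2.*2 by rewrite even_halfK.
rewrite [in RHS]q2 big_nat_double /delta0; congr (_ + _).
  by apply: eq_bigr => j _; rewrite /F mul2n odd_double addbF.
rewrite big_add1 /=; apply: eq_big_nat => j /andP[_ jq].
rewrite mulnS add2n subn1 /F /= mul2n odd_double addbT.
(* [delta0] reads odd positions with default [Lv]; the index [2 * j + 1] is in range, so the default
   can be exchanged. *)
rewrite (set_nth_default Lf) ?size_tuple; last by rewrite q2 ltn_Sdouble.
by case: (nth _ _ _).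
Qed.

Lemma bits_inj : injective (@bits q).
Proof.
move=> w w' /setP E; apply: eq_from_tnth => j; have := E j; rewrite !inE.
by case: (tnth w j); case: (tnth w' j); case: (odd j).
Qed.

Lemma bits_surj A : exists w, bits w = A.
Proof.
exists [tuple letter_of_bool ((j \in A) (+) odd j) | j < q].
apply/setP => j; rewrite inE tnth_mktuple.
by case: (j \in A); case: (odd j).
Qed.

Lemma card_bits (P : pred {set 'I_q}) :
  #|[set w : word q | P (bits w)]| = #|[set A | P A]|.
Proof.
rewrite -(card_imset _ bits_inj); apply: eq_card => A; rewrite !inE.
apply/imsetP/idP => [[w]|PA]; first by rewrite inE => + ->.
by have [w wA] := bits_surj A; exists w; rewrite // inE wA.
Qed.

(** Rotation by one changes the parity of the position of every letter, which complements the
    rotated bits; the dual in [twist] undoes the complement. *)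
Lemma mem_bits_tau w j : (j \in bits (tau w)) = ~~ (ordS j \in bits w).
Proof. by rewrite !inE tnth_tau odd_ordS // addbN negbK. Qed.

Lemma mem_bits_dual w j : (j \in bits (dual w)) = ~~ (j \in bits w).
Proof. by rewrite !inE tnth_map; case: (tnth w j); case: (odd j). Qed.

Lemma mem_bits_iter_tau n w j :
  (j \in bits (iter n (@tau q) w)) = (iter n (@ordS q) j \in bits w) (+) odd n.
Proof.
elim: n j => [|n IH] j; first by rewrite addbF.
by rewrite iterS mem_bits_tau IH /= addbN -iterSr.
Qed.

Lemma delta0_twist w : delta0 (twist w) = delta0 w.
Proof.
rewrite !delta0_bits -(card_imset _ (@ordS_inj q)); apply: eq_card => j.
apply/imsetP/idP => [[i]|jw].
  by rewrite mem_bits_dual mem_bits_tau negbK => + ->.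
exists (ord_pred j); last by rewrite ord_predK.
by rewrite mem_bits_dual mem_bits_tau negbK ord_predK.
Qed.

Lemma iter_tau_twist n w : iter n (@tau q) (twist w)
  = twist (iter n (@tau q) w).
Proof. by elim: n => //= n ->; rewrite -dual_tau. Qed.

Lemma order_tau_twist w : order (@tau q) (twist w) = order (@tau q) w.
Proof.
have E n : (order (@tau q) (twist w) %| n) = (order (@tau q) w %| n).
  by rewrite -!(iter_fixP _ _ (@tau_inj q)) iter_tau_twist (inj_eq (@twist_inj
    q)).
by apply/eqP; rewrite eqn_dvd E dvdnn -E dvdnn.
Qed.

Lemma primitive_twist w : primitive (twist w) <-> primitive w.
Proof.
split=> /(primitiveP q0) h; apply/(primitiveP q0).
  by rewrite -order_tau_twist.
by rewrite order_tau_twist.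
Qed.

Lemma self_dual_twist w : self_dual (twist w) <-> self_dual w.
Proof.
split=> -[n E]; exists n.
  by apply: (@twist_inj q); rewrite -iter_tau_twist -E /twist !dual_tau.
by rewrite iter_tau_twist -E /twist !dual_tau.
Qed.

Lemma iter_twist n w :
  iter n (@twist q) w = iter n (@tau q) (if odd n then dual w else w).
Proof.
elim: n => // n IH; rewrite iterS IH /= /twist dual_tau dual_iter_tau.
by case: (odd n) => //=; rewrite dualK.
Qed.

(** For [n] odd, [twist^n w] is [tau^n] of the dual word, so a return to [w] would make [w]
    self-dual. For [n] even it is [tau^n w], and primitivity forces [q] to divide [n]. *)
Lemma order_twist w : primitive w -> ~ self_dual w -> order (@twist q) w = q.
Proof.
move=> /(primitiveP q0) ordq nsd; apply/eqP; rewrite eqn_dvd.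
rewrite -(iter_fixP _ _ (@twist_inj q)) iter_twist (negPf qe) iter_tauq eqxx /=.
have := iter_order (@twist_inj q) w; rewrite iter_twist.
case: ifP => [_ E|_ /eqP]; last by rewrite (iter_fixP _ _ (@tau_inj q)) ordq.
case: nsd; exists (order (@twist q) w); apply: dual_inj.
by rewrite dualK -[LHS]E dual_iter_tau.
Qed.

Section Bound.
Variable b : nat.

Definition bicycle_words : {set word q} := (Pset q b :\: Uset q b)%SET.

Lemma bicycle_wordsP w :
  reflect [/\ primitive w, ~ self_dual w & delta0 w = b] (w \in bicycle_words).
Proof.
rewrite !inE; apply: (iffP idP) => [/andP[+ /andP[/asboolP pw dw]]|[pw sw dw]].
  rewrite dw andbT negb_and => h; split=> //; last exact/eqP.
  by move/asboolP=> sw; move: h; rewrite sw orbF; case/negP; apply/asboolP.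
rewrite dw eqxx; have -> : `[<self_dual w>] = false by apply/asboolP.
by rewrite andbF; apply/andP; split=> //; rewrite andbT; apply/asboolP.
Qed.

Lemma bicycle_words_closed : fclosed (@twist q) (mem bicycle_words).
Proof.
move=> w _ /eqP <-; apply/bicycle_wordsP/bicycle_wordsP => -[pw sw dw].
  by split; rewrite ?delta0_twist ?primitive_twist ?self_dual_twist.
split; [exact/primitive_twist | by move/self_dual_twist | by rewrite
  -delta0_twist].
Qed.

Lemma card_bicycle_words :
  fcard (@twist q) bicycle_words * q = #|Pset q b| - #|Uset q b|.
Proof.
rewrite (fcard_order_set (@twist_inj q) _ bicycle_words_closed).
  rewrite cardsDS //; apply/fintype.subsetP => w.
  by rewrite inE => /andP[].
apply/fintype.subsetP => w /bicycle_wordsP[pw sw _].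
by rewrite inE; apply/eqP/order_twist.
Qed.

End Bound.
End Bits.

(** * Isomorphism classes correspond to orbits of words *)

Section Classes.
Variables (k : closedFieldType) (p : nat).
Hypotheses (hp : p \in [pchar k]%R) (hp2 : (2 < p)%N).
Variables (q b : nat).
Hypotheses (q0 : (0 < q)%N) (qe : ~~ odd q) (hb : (b <= q)%N).

Lemma std_bicycle w : w \in bicycle_words q b ->
  unitary_bicycle (std_unitaryBT1 hp hp2 w qe).
Proof.
case/bicycle_wordsP => pw sw _; exists q, w; split=> //.
exact: standard_basis_Mtilde (std_standard_basis _ _ _ _).
Qed.

Lemma iso_class_eq (M N : unitaryBT1 k p) :
  isomorphic M N -> iso_class M = iso_class N.
Proof.
move=> MN; apply/funext => L; apply/propext; split=> h.
  exact: isomorphic_trans (isomorphic_sym MN) h.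
exact: isomorphic_trans MN h.
Qed.

Lemma bicycle_standard_basis (M : unitaryBT1 k p) :
  unitary_bicycle M -> has_signature M ((q - b)%N, b) ->
  exists2 w, w \in bicycle_words q b &
    exists e : bool * 'I_q -> M, standard_basis w e.
Proof.
case=> l [w [l0 le pw sw /Mtilde_standard_basis[e he]]] sig.
have [lb bb] := has_signature_inj (standard_signature hp he) sig.
(* The two entries of the signature add up to the length of the word. *)
have lq : l = q.
  have := max_card (mem (bits w)); rewrite card_ord bb => bl.
  by rewrite -(subnK bl) -bb lb bb subnK.
move: w pw sw e he {sig lb} bb; rewrite lq => w pw sw e he bb.
exists w; last by exists e.
by apply/bicycle_wordsP; split; rewrite ?delta0_bits.
Qed.

(** Classes are indexed by the roots of the orbits inside [bicycle_words]. A bicycle given by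
    another word of an orbit is brought to the root by changing its standard basis. *)
Lemma has_card_bicycles :
  has_card (Bi_tilde k p ((q - b)%N, b)) (fcard (@twist q) (bicycle_words q b)).
Proof.
pose A := predI (froots (@twist q)) (mem (bicycle_words q b)).
pose M w := std_unitaryBT1 hp hp2 w qe.
have hM w := std_standard_basis hp hp2 w qe.
exists (fun i : 'I_#|A| => iso_class (M (enum_val i))); split.
  move=> i j E; apply: enum_val_inj.
  have iso : isomorphic (M (enum_val i)) (M (enum_val j)).
    by rewrite -/(iso_class _ _) E; apply: standard_basis_isomorphic (hM _) (hM
      _).
  have := isomorphic_fconnect hp qe q0 (hM _) (hM _) iso.
  rewrite -(root_connect (fconnect_sym (@twist_inj q))) => /eqP.
  have /andP[/eqP -> _] := enum_valP i.
  by have /andP[/eqP -> _] := enum_valP j.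
move=> C; split=> [[N [bN sN ->]]|[i ->]].
  have [w wX [e he]] := bicycle_standard_basis bN sN.
  have w_root : froot (@twist q) w \in A.
    apply/andP; split; first exact: roots_root (fconnect_sym (@twist_inj q)) w.
    have E := closed_connect (@bicycle_words_closed q q0 qe b)
      (connect_root (frel (@twist q)) w).
    exact: etrans (esym E) wX.
  exists (enum_rank_in w_root (froot (@twist q) w)); rewrite enum_rankK_in //.
  have [e' he'] := standard_basis_orbit qe he (connect_root (frel (@twist q))
    w).
  exact/iso_class_eq/(standard_basis_isomorphic hp he' (hM _)).
exists (M (enum_val i)); split=> //.
  by apply: std_bicycle; have /andP[] := enum_valP i.
have /andP[_ /bicycle_wordsP[_ _ dw]] := enum_valP i.
have := standard_signature hp (hM (enum_val i)).
by rewrite -delta0_bits // dw.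
Qed.

End Classes.

(** * Counting periodic words *)

(** With [eps] set, membership is complemented after [h] steps. One full turn closes up only if the
    number of blocks of length [h] is then even; hence the hypothesis [neps] below. *)
Definition quasi_periodic (q h : nat) (eps : bool) (A : {set 'I_q}) : bool :=
  [forall j, (iter h (@ordS q) j \in A) == (j \in A) (+) eps].

Section QuasiPeriodic.
Variables (q n h : nat) (eps : bool).
Hypotheses (q0 : (0 < q)%N) (qE : q = (n * h.+1)%N) (neps : eps -> ~~ odd n).
Implicit Types (A : {set 'I_q}) (B : {set 'I_h.+1}).

(** The inverse is restriction to the first block. The period is written [h.+1] because [inord]
    needs an inhabited ordinal type. *)
Definition unfold_pattern B : {set 'I_q} :=
  [set j : 'I_q | (inord (j %% h.+1) \in B) (+) (eps && odd (j %/ h.+1))].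

Let n0 : (0 < n)%N.
Proof. by move: q0; rewrite qE muln_gt0 => /andP[]. Qed.

Let hq : (h.+1 <= q)%N.
Proof. by rewrite qE leq_pmull. Qed.

Lemma unfold_pattern_inj : injective unfold_pattern.
Proof.
move=> B B' /setP E; apply/setP => r; have := E (widen_ord hq r).
rewrite !inE /= divn_small ?ltn_ord // andbF !addbF.
by rewrite modn_small ?ltn_ord // inord_val.
Qed.

Let modq_div x : x %% q %/ h.+1 = (x %/ h.+1) %% n.
Proof. by rewrite qE modn_divl. Qed.

Let modq_mod x : (x %% q) %% h.+1 = x %% h.+1.
Proof. by rewrite qE modn_dvdm // dvdn_mull. Qed.

Let eps_mod x : eps && odd (x %% n) = eps && odd x.
Proof. by case: eps neps => //= ne; rewrite odd_mod //; apply/negbTE/ne. Qed.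

Lemma quasi_periodic_unfold B : quasi_periodic h.+1 eps (unfold_pattern B).
Proof.
apply/forallP => j; rewrite !inE val_iter_ordS modq_div modq_mod eps_mod.
rewrite modnDr divnDr // divnn /= addn1 /= -addbA; apply/eqP.
by case: eps; rewrite //= addbT.
Qed.

Lemma quasi_periodic_pattern A :
  quasi_periodic h.+1 eps A -> exists B, unfold_pattern B = A.
Proof.
move/forallP=> perA; exists [set r : 'I_h.+1 | widen_ord hq r \in A].
have per m j : (iter (m * h.+1) (@ordS q) j \in A)
  = (j \in A) (+) (eps && odd m).
  elim: m => [|m IH]; first by rewrite andbF addbF.
  rewrite mulSn iterD (eqP (perA _)) IH -addbA; congr (_ (+) _).
  by case: eps; rewrite //= addbT.
apply/setP => j; rewrite !inE.
set r := widen_ord _ _.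
have jE : j = iter (j %/ h.+1 * h.+1) (@ordS q) r.
  apply: val_inj; rewrite [RHS]val_iter_ordS /= inordK ?ltn_mod //.
  by rewrite addnC -divn_eq modn_small.
by rewrite [in RHS]jE per.
Qed.

Lemma card_unfold_pattern B :
  #|unfold_pattern B| = (\sum_(0 <= i < n)
    if eps && odd i then h.+1 - #|B| else #|B|)%N.
Proof.
pose G (j : nat) : nat := (inord (j %% h.+1) \in B) (+) (eps && odd (j %/
  h.+1)).
have -> : #|unfold_pattern B| = (\sum_(0 <= j < q) G j)%N.
  rewrite big_mkord -sum1_card big_mkcond /=; apply: eq_bigr => j _.
  by rewrite inE /G; case: (_ (+) _).
rewrite [in LHS]qE big_nat_mul; apply: eq_bigr => i _.
rewrite -{1}[i * h.+1]add0n big_addn mulSn addnK big_mkord.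
have BC : (#|B| + #|~: B|)%N = h.+1 by rewrite cardsC card_ord.
transitivity (\sum_(r < h.+1) ((r \in B) (+) (eps && odd i) : nat))%N.
  apply: eq_bigr => r _; rewrite /G addnC modnMDl divnMDl //.
  by rewrite divn_small // addn0 modn_small // inord_val.
transitivity #|[set r : 'I_h.+1 | (r \in B) (+) (eps && odd i)]|.
  rewrite -sum1_card [RHS]big_mkcond /=; apply: eq_bigr => r _.
  by rewrite inE; case: (_ (+) _).
case: ifP => _; last by apply: eq_card => r; rewrite inE addbF.
by rewrite -[X in (X - _)%N]BC addKn; apply: eq_card => r; rewrite !inE addbT.
Qed.

(** With [eps], two consecutive blocks are complementary, so every pattern unfolds to exactly
    [q / 2] elements: all [2 ^ h.+1] patterns count or none does. Without [eps], the pattern is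
    copied [n] times and must have [b / n] elements. *)
Lemma card_quasi_periodic b :
  #|[set A : {set 'I_q} | quasi_periodic h.+1 eps A && (#|A| == b)]|
  = (if eps then if b.*2 == q then 2 ^ h.+1 else 0
     else if n %| b then 'C(h.+1, b %/ n) else 0)%N.
Proof.
have -> : #|[set A : {set 'I_q} | quasi_periodic h.+1 eps A && (#|A| == b)]|
    = #|[set B | #|unfold_pattern B| == b]|.
  rewrite -(card_imset _ unfold_pattern_inj); apply: eq_card => A; rewrite !inE.
  apply/andP/imsetP => [[/quasi_periodic_pattern[B <-] Bb]|[B + ->]].
    by exists B; rewrite // inE.
  by rewrite inE quasi_periodic_unfold.
case e: eps; last first.
  have cU B : #|unfold_pattern B| = (n * #|B|)%N.
    by rewrite card_unfold_pattern e /= sum_nat_const_nat subn0.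
  case: ifP => [/dvdnP[m ->]|nb].
    rewrite mulnK // -[X in 'C(X, _)]card_ord -card_draws.
    by apply: eq_card => B; rewrite !inE cU mulnC eqn_pmul2r.
  apply: eq_card0 => B; rewrite !inE cU.
  by apply: contraFF nb => /eqP <-; rewrite dvdn_mulr.
have cU B : #|unfold_pattern B|.*2 = q.
  rewrite card_unfold_pattern e /=.
  have {1}-> : n = n./2.*2 by rewrite even_halfK // neps.
  rewrite big_nat_double.
  under eq_bigr do rewrite mul2n odd_double.
  under [X in (_ + X)%N]eq_bigr do rewrite /= mul2n odd_double /=.
  rewrite !sum_nat_const_nat subn0 -mulnDr subnKC; last first.
    by rewrite -[X in _ <= X]card_ord max_card.
  by rewrite -mul2n mulnA mul2n even_halfK ?neps // -qE.
case: ifP => bq.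
  rewrite -[X in 2 ^ X]card_ord -cardsT -card_powerset powersetT.
  by apply: eq_card => B; rewrite !inE -(inj_eq double_inj) cU eq_sym bq.
apply: eq_card0 => B; rewrite !inE -(inj_eq double_inj) cU.
by rewrite eq_sym bq.
Qed.
End QuasiPeriodic.

Section FixedWords.
Variable q : nat.
Hypotheses (q0 : (0 < q)%N) (qe : ~~ odd q).
Implicit Types w : word q.

Lemma card_words_quasi_periodic (Q : pred (word q)) h (eps : bool) b :
  (0 < h)%N -> h %| q -> (eps -> ~~ odd (q %/ h)) ->
  (forall w, Q w = quasi_periodic h eps (bits w)) ->
  #|[set w : word q | Q w && (delta0 w == b)]|
  = (if eps then if b.*2 == q then 2 ^ h else 0
     else if q %/ h %| b then 'C(h, b %/ (q %/ h)) else 0)%N.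
Proof.
case: h => // h _ hq he QE.
rewrite -(card_quasi_periodic q0 _ he); last by rewrite divnK.
rewrite -card_bits; apply: eq_card => w.
by rewrite !inE QE delta0_bits.
Qed.

(** Each rotation complements the bits, so a word fixed by [tau^h] has periodic bits for [h] even
    and bits complemented after [h] steps for [h] odd. Fixing up to duality reverses the two
    cases. *)
Lemma iter_tau_fix_bits h w :
  (iter h (@tau q) w == w) = quasi_periodic h (odd h) (bits w).
Proof.
rewrite -(inj_eq (@bits_inj q)); apply/eqP/forallP => [/setP E j|per].
  by rewrite -(E j) mem_bits_iter_tau // -addbA addbb addbF.
apply/setP => j; rewrite mem_bits_iter_tau // (eqP (per j)).
by rewrite -addbA addbb addbF.
Qed.

Lemma iter_tau_dual_bits h w :
  (iter h (@tau q) w == dual w) = quasi_periodic h (~~ odd h) (bits w).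
Proof.
rewrite -(inj_eq (@bits_inj q)); apply/eqP/forallP => [/setP E j|per].
  have := E j; rewrite mem_bits_dual mem_bits_iter_tau //
    => /(canRL (addbK _)) ->.
  by rewrite addbN addNb.
apply/setP => j; rewrite mem_bits_dual mem_bits_iter_tau // (eqP (per j)).
by rewrite -addbA addNb addbb addbT.
Qed.

Lemma card_fixed_words d b : d %| q ->
  #|[set w : word q | (iter (q %/ d) (@tau q) w == w) && (delta0 w == b)]|
  = (if odd (q %/ d) then if b.*2 == q then 2 ^ (q %/ d) else 0
     else if d %| b then 'C(q %/ d, b %/ d) else 0)%N.
Proof.
move=> dq; have d0 := dvdn_gt0 q0 dq.
have qd0 : (0 < q %/ d)%N by rewrite divn_gt0 // dvdn_leq.
have dE : q %/ (q %/ d) = d by rewrite divnA // mulKn.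
rewrite (@card_words_quasi_periodic _ (q %/ d) (odd (q %/ d)) b) //.
- by rewrite dE.
- by rewrite dvdn_div.
(* As [q] is even, [q / d] odd makes the number [d] of blocks even. *)
- by rewrite dE => od; apply: contra qe => odd_d;
    rewrite -(divnK dq) oddM od odd_d.
- exact: iter_tau_fix_bits.
Qed.

Lemma card_antifixed_words h b : (0 < h)%N -> h %| q -> ~~ odd (q %/ h) ->
  #|[set w : word q | (iter h (@tau q) w == dual w) && (delta0 w == b)]|
  = (if odd h then if q %/ h %| b then 'C(h, b %/ (q %/ h)) else 0
     else if b.*2 == q then 2 ^ h else 0)%N.
Proof.
move=> h0 hq qh.
rewrite (@card_words_quasi_periodic _ h (~~ odd h) b) // => [|w].
  by case: (odd h).
exact: iter_tau_dual_bits.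
Qed.

(* The [d] with [tau^(q/d) w = w] are the divisors of [q / order tau w]. *)
Lemma card_primitive_words (Q : pred (word q)) :
  (#|[set w : word q | `[<primitive w>] && Q w]|%:Z
   = \sum_(d <- divisors q)
       mobius d * #|[set w | (iter (q %/ d) (@tau q) w == w) && Q w]|%:Z)%R.
Proof.
have cardE (P : pred (word q)) :
    (#|[set w | P w && Q w]|%:Z = \sum_(w | Q w) (P w)%:R)%R.
  rewrite -sum1_card -natz natr_sum big_mkcond /= [RHS]big_mkcond /=.
  by apply: eq_bigr => w _; rewrite inE; case: (P w); case: (Q w).
rewrite cardE; under [RHS]eq_bigr do rewrite cardE mulr_sumr.
rewrite exchange_big; apply: eq_bigr => w _.
have /dvdnP[D qD] := order_tau_dvd w; set o := order _ w in qD.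
have o0 : (0 < o)%N by rewrite order_gt0.
have D0 : (0 < D)%N by move: q0; rewrite qD muln_gt0 => /andP[].
have -> : `[<primitive w>] = (D == 1).
  apply/asboolP/eqP => [/(primitiveP q0) oq|D1].
    by apply/eqP; rewrite -(eqn_pmul2r o0) -qD mul1n /o oq.
  by apply/(primitiveP q0); rewrite [RHS]qD D1 mul1n.
rewrite -sum_mobius // (big_divisors (n := q) (Q := fun d => d %| D)) //.
  rewrite big_mkcond big_seq_cond [RHS]big_seq_cond.
  apply: eq_bigr => d; rewrite andbT -dvdn_divisors // => dq.
  rewrite iter_fixP; last exact: tau_inj.
  have -> : (o %| q %/ d) = (d %| D).
    rewrite -(@dvdn_pmul2r d) ?(dvdn_gt0 q0) // divnK // qD mulnC.
    by rewrite dvdn_pmul2r.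
  by case: ifP; rewrite ?mulr1 ?mulr0.
move=> d; rewrite andbT; apply/idP/andP => [dD|[]//].
by split=> //; rewrite qD dvdn_mulr.
Qed.

End FixedWords.

(** * Moebius formulas for [Pset] and [Uset] *)

Section Count.
Variables (q b : nat).
Hypotheses (q0 : (0 < q)%N) (qe : ~~ odd q).

Lemma card_Pset :
  (#|Pset q b|%:Z = \sum_(d <- divisors q) mobius d *
     (if odd (q %/ d) then if b.*2 == q then 2 ^ (q %/ d) else 0
      else if d %| b then 'C(q %/ d, b %/ d) else 0)%N%:Z)%R.
Proof.
rewrite /Pset (card_primitive_words q0 (fun w => delta0 w == b)).
rewrite big_seq [RHS]big_seq; apply: eq_bigr => d.
by rewrite -dvdn_divisors // => dq; rewrite card_fixed_words.
Qed.

(** Moebius inversion is applied to words with [tau^(q/2) w] equal to the dual. For [d] odd and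
    [h = q / (2 * d)], [q / 2] is [h] modulo [2 * h], so the conditions for [d] merge into [tau^h w]
    being the dual. For [d] even, [q / 2] is a multiple of [q / d] and [w] would equal its dual, so
    the term is 0. *)
Lemma card_Uset :
  (#|Uset q b|%:Z = \sum_(d <- odd_divisors q) mobius d *
     (if odd (q %/ (2 * d))
      then if 2 * d %| b then 'C(q %/ (2 * d), b %/ (2 * d)) else 0
      else if b.*2 == q then 2 ^ (q %/ (2 * d)) else 0)%N%:Z)%R.
Proof.
pose Q (w : word q) := (iter q./2 (@tau q) w == dual w) && (delta0 w == b).
have -> : Uset q b = [set w | `[<primitive w>] && Q w]%SET.
  apply/setP => w; rewrite !inE /Q [RHS]andbCA [RHS]andbC -andbA.
  case: asboolP => //= pw; congr andb.
  by apply/asboolP/eqP => /(self_dual_primitiveP q0 qe pw).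
rewrite card_primitive_words // /odd_divisors big_filter [RHS]big_mkcond /=.
rewrite big_seq [RHS]big_seq; apply: eq_bigr => d;
  rewrite -dvdn_divisors // => dq.
have d0 := dvdn_gt0 q0 dq.
have q2 : q = q./2.*2 by rewrite even_halfK.
case: ifP => od.
  have d2 : d %| q./2 by move: dq; rewrite {1}q2 -mul2n Gauss_dvdr //
    coprimen2 od.
  have qE : q = q %/ (2 * d) * (2 * d).
    by rewrite divnK // q2 -mul2n dvdn_pmul2l.
  set h := q %/ (2 * d) in qE *.
  have h0 : (0 < h)%N by move: q0; rewrite qE muln_gt0 => /andP[].
  have hE : q %/ h = 2 * d by rewrite qE mulKn.
  have qd : q %/ d = h + h by rewrite qE mulnA mulnK // muln2 addnn.
  have q2h : q./2 = h + d./2 * (h + h).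
    rewrite {1}qE -{1}(odd_double_half d) od mulnCA mul2n doubleK mulnDr muln1.
    by rewrite addnn -!muln2 mulnCA.
  congr (_ * _%:Z)%R.
  rewrite -[X in if _ then if X %| _ then 'C(_, _ %/ X) else _ else _]hE.
  rewrite -card_antifixed_words //; first last.
  - by rewrite hE mul2n odd_double.
  - by rewrite qE dvdn_mulr.
  apply: eq_card => w; rewrite !inE /Q qd andbA; congr andb.
  have per m u : iter (h + h) (@tau q) u = u -> iter (m * (h + h)) (@tau q) u =
    u.
    by move=> E; elim: m => // m IH; rewrite mulSn iterD IH E.
  apply/andP/eqP => [[/eqP E /eqP <-]|E].
    by rewrite q2h iterD per.
  have E2 : iter (h + h) (@tau q) w = w.
    by rewrite iterD E -dual_iter_tau E dualK.
  split; apply/eqP; first exact: E2.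
  by rewrite q2h iterD per.
rewrite (_ : #|_| = 0) ?mulr0 //; apply: eq_card0 => w; rewrite !inE /Q.
apply/negbTE/negP => /andP[/eqP E /andP[/eqP E2 _]].
have : iter q./2 (@tau q) w = w.
  have -> : q./2 = d./2 * (q %/ d).
    rewrite -[in LHS](divnK dq) -{2}(odd_double_half d) od -muln2 mulnA muln2
      doubleK.
    by rewrite mulnC.
  by elim: (d./2) => // m IH; rewrite mulSn iterD IH.
rewrite E2 => /(congr1 (fun u => tnth u (Ordinal q0))).
by rewrite tnth_map; case: (tnth w _).
Qed.

Lemma card_UsetS : (#|Uset q b| <= #|Pset q b|)%N.
Proof. by apply/subset_leq_card/fintype.subsetP => w;
  rewrite inE => /andP[]. Qed.

End Count.


Local Open Scope ring_scope.

Theorem corollaryA26 (k : closedFieldType) (p : nat) (hp : p \in [pchar k])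
    (hp2 : (2 < p)%N) (q b : nat) (hq : (0 < q)%N) (hqe : ~~ odd q)
    (hb : (b <= q)%N) :
  exists N : nat,
    [/\ has_card (Bi_tilde k p ((q - b)%N, b)) N,
        N%:Q = q%:Q^-1 * (#|Pset q b|%:Q - #|Uset q b|%:Q),
        b = (q %/ 2)%N ->
          ((q %% 4 = 0)%N ->
            N%:Q = q%:Q^-1 *
              (\sum_(d <- coeven_divisors q)
                  mobius d * 'C(q %/ d, q %/ (2 * d))%:Z
               + \sum_(d <- coodd_divisors q) mobius d * (2 ^ (q %/ d))%N%:Z
               - \sum_(d <- odd_divisors q)
                   mobius d * (2 ^ (q %/ (2 * d)))%N%:Z)%:~R)
          /\ ((q %% 4 = 2)%N ->
            N%:Q = q%:Q^-1 *
              (\sum_(d <- coeven_divisors q)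
                  mobius d * 'C(q %/ d, q %/ (2 * d))%:Z
               + \sum_(d <- coodd_divisors q)
                   mobius d * (2 ^ (q %/ d))%N%:Z)%:~R)
      & b <> (q %/ 2)%N ->
          if (q %% 4 == 2)%N && ~~ odd b then
            N%:Q = q%:Q^-1 *
              (\sum_(d <- wcoeven_divisors q b)
                  mobius d * 'C(q %/ d, b %/ d)%:Z
               - \sum_(d <- odd_divisors (gcdn q b))
                   mobius d * 'C(q %/ (2 * d), b %/ (2 * d))%:Z)%:~R
          else
            N%:Q = q%:Q^-1 *
              (\sum_(d <- wcoeven_divisors q b)
                  mobius d * 'C(q %/ d, b %/ d)%:Z)%:~R].
Proof.
exists (fcard (@twist q) (bicycle_words q b)); set N := fcard _ _.
have NE : N%:Q = q%:Q^-1 * (#|Pset q b|%:Z - #|Uset q b|%:Z)%:~R.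
  have q_neq0 : q%:Q != 0 by rewrite intr_eq0 -lt0n.
  apply: (mulfI q_neq0); rewrite mulVKf // -!intrM; congr (_%:~R).
  by rewrite -PoszM mulnC /N card_bicycle_words // subzn // card_UsetS.
have q2 : q = q./2.*2 by rewrite even_halfK.
have halfq : (b = q %/ 2)%N <-> b.*2 = q.
  by rewrite divn2 [in X in _ <-> X]q2; split=> [->|/double_inj].
(* The source of the distinction modulo 4: for [d] odd, [q / (2 * d)] has the parity of [q / 2]. *)
have odd_quot d : (d %| q)%N -> odd d ->
    odd (q %/ (2 * d))%N = (q %% 4 == 2)%N.
  move=> dq od; have dq2 : (2 * d %| q)%N.
    by rewrite q2 -mul2n dvdn_pmul2l // -(@Gauss_dvdr _ 2) ?coprimen2 //
      mul2n -q2.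
  have -> : (q %% 4 == 2)%N = odd q./2.
    by rewrite {1}q2 -mul2n -[4%N]/(2 * 2)%N -muln_modr modn2; case: odd.
  rewrite -[X in X./2](divnK dq2); set h := (q %/ _)%N.
  by rewrite mulnCA mul2n doubleK oddM od andbT.
split.
- exact: has_card_bicycles.
- by rewrite NE rmorphB.
- move=> bE; have bq := halfq.1 bE.
  have P_eq : #|Pset q b|%:Z = \sum_(d <- coeven_divisors q)
       mobius d * 'C(q %/ d, q %/ (2 * d))%:Z
     + \sum_(d <- coodd_divisors q) mobius d * (2 ^ (q %/ d))%N%:Z.
    rewrite card_Pset // bq eqxx (bigID (fun d => odd (q %/ d))) /= addrC.
    rewrite /coeven_divisors /coodd_divisors !big_filter; congr (_ + _).
      rewrite big_seq_cond [RHS]big_seq_cond; apply: eq_bigr => d.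
      rewrite -dvdn_divisors // => /andP[dq oq]; rewrite (negPf oq).
      have d0 := dvdn_gt0 hq dq.
      (* Since [q / d] is even, [d] divides [q / 2 = b]. *)
      have db : (d %| b)%N.
        have e2 : (q %/ d)%N = (q %/ d)%N./2.*2 by rewrite even_halfK.
        apply/dvdnP; exists (q %/ d)%N./2; apply: double_inj.
        by rewrite bq doubleMl -e2 divnK.
      by rewrite db bE -divnMA.
    by apply: eq_bigr => d ->.
  split=> q4; rewrite NE P_eq.
    congr (_ * (_ - _)%:~R); rewrite card_Uset // bq eqxx big_filter.
    rewrite /odd_divisors big_filter.
    rewrite big_seq_cond [RHS]big_seq_cond; apply: eq_bigr => d.
    by rewrite -dvdn_divisors // => /andP[dq od]; rewrite odd_quot // q4.
  have -> : #|Uset q b|%:Z = 0; last by rewrite subr0.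
  rewrite card_Uset // big_filter big_seq_cond big1 // => d.
  rewrite -dvdn_divisors // => /andP[dq od]; rewrite odd_quot // q4 /=.
  (* The case [d = 1] of [odd_quot] shows that [b = q / 2] is odd; no [2 * d] divides it and [Uset]
     is empty. *)
  have ob : odd b.
    have := odd_quot 1%N (dvd1n q) isT.
    by rewrite muln1 q4 -bE.
  case: ifP => [/dvdnP[c bc]|]; last by rewrite mulr0.
  by rewrite bc mulnCA mul2n odd_double in ob.
- move=> bE.
  have bq : (b.*2 == q) = false by apply/eqP => /halfq.
  have g0 : (0 < gcdn q b)%N by rewrite gcdn_gt0 hq.
  have P_eq : #|Pset q b|%:Z
      = \sum_(d <- wcoeven_divisors q b) mobius d * 'C(q %/ d, b %/ d)%:Z.
    (* As [b] differs from [q / 2], co-odd divisors contribute 0, and the others count only if they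
       also divide [b]. *)
    rewrite card_Pset // bq /wcoeven_divisors big_filter.
    rewrite -(@big_divisors _ q (gcdn q b)
      (fun d => (d %| b)%N && ~~ odd (q %/ d)%N)) // => [|d]; last first.
      by rewrite dvdn_gcd andbA.
    rewrite [RHS]big_mkcond; apply: eq_bigr => d _.
    by case: odd; case: (d %| b)%N; rewrite ?mulr0.
  have U_eq : #|Uset q b|%:Z = if (q %% 4 == 2)%N && ~~ odd b then
      \sum_(d <- odd_divisors (gcdn q b))
        mobius d * 'C(q %/ (2 * d), b %/ (2 * d))%:Z else 0.
    rewrite card_Uset // bq /odd_divisors big_filter.
    (* For [d] odd, [2 * d] divides [b] exactly when [b] is even and [d] divides [b]. *)
    have dE d : (d %| q)%N && odd d -> (if odd (q %/ (2 * d))%N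
        then if (2 * d %| b)%N then 'C(q %/ (2 * d), b %/ (2 * d)) else 0%N
        else 0%N) = if [&& (q %% 4 == 2)%N, ~~ odd b & (d %| b)%N]
                    then 'C(q %/ (2 * d), b %/ (2 * d)) else 0%N.
      case/andP=> dq od; rewrite odd_quot //; case: (_ == _) => //=.
      by rewrite Gauss_dvd ?coprime2n // dvdn2.
    rewrite big_seq_cond.
    under eq_bigr => d dP.
      rewrite dE; last by rewrite (dvdn_divisors _ hq).
      over.
    rewrite -big_seq_cond; case: andP => [[q4 eb]|nh]; last first.
      rewrite big1 // => d _; rewrite andbA.
      by case: andP => [[/andP[q4 eb] _]|_]; [case: nh | rewrite mulr0].
    rewrite q4 eb /= big_filter -(@big_divisors _ q (gcdn q b)
      (fun d => (d %| b)%N && odd d)) // => [|d]; last first.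
      by rewrite dvdn_gcd andbA.
    rewrite [LHS]big_mkcond [RHS]big_mkcond; apply: eq_bigr => d _.
    by case: (odd d); case: (d %| b)%N; rewrite ?mulr0.
  rewrite NE P_eq; case: ifP => c; rewrite U_eq c //.
  by rewrite subr0.
Qed.
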